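(* Let $\varepsilon>0$ be fixed. Let $q$ be a sufficiently large prime, let $H\mid q-1$ be even, and let $\mathcal{H}$ be the subgroup of $\mathcal{X}_q$ of order $\#\mathcal{H}=H$. Let $\mathcal{H}^+$ be the subgroup of $\mathcal{X}_q$ of order $H/2$ (equivalently, of index $2(q-1)/H$), all of whose characters are even. If $H\ge q^{1/2+\varepsilon}$, then there exists a non-principal character $\chi\in\mathcal{H}^+$ such that $$\left|L\left(\tfrac12,\chi\right)\right|\gg\left(\frac{H}{q}\right)^{1/2}\exp\left((\sqrt2+o(1))\sqrt{\frac{\left(\log\left(H/\sqrt q\right)\right)\log_3 H}{\log_2 H}}\right),$$ where $o(1)$ denotes a quantity tending to $0$ as $q\to\infty$.
   Context: $\mathcal{X}_q$ is the group of multiplicative (Dirichlet) characters modulo $q$; for $q$ prime it is cyclic of order $q-1$. A character $\chi$ is even if $\chi(-1)=1$. For a non-principal $\chi\in\mathcal{X}_q$, $L(s,\chi)=\sum_{n\ge1}\chi(n)n^{-s}$ for $\Re s>0$. $A\gg B$ means $|B|\le cA$ for some constant $c>0$; the implied constant and the $o(1)$ may depend on $\varepsilon$. Iterated logarithms: $\log_1 z=\max\{2,\log z\}$ and, for $\nu\ge2$, $\log_\nu z=\max\{2,\log(\log_{\nu-1}z)\}$ (not base-$\nu$ logarithms). *)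

(* Defs.v *)
From HB Require Import structures.
From mathcomp Require Export all_boot all_order all_algebra finmap.
From mathcomp Require Export complex.
From mathcomp Require Export all_classical all_reals all_analysis.

Set Implicit Arguments.
Unset Strict Implicit.
Unset Printing Implicit Defensive.

Export Order.TTheory GRing.Theory Num.Theory.
Export numFieldNormedType.Exports.

#[global] Open Scope classical_set_scope.
#[global] Open Scope ring_scope.
#[global] Open Scope complex_scope.

(** A Dirichlet character is a complex-valued function on the residues modulo
    [q], extended by zero outside the units. The type ['Z_q] is the ring of
    integers modulo [q] only when [1 < q]. *)
Definition is_dirichlet_char (R : realType) (q : nat)
    (f : {ffun 'Z_q -> R[i]}) : bool :=
  [forall x, (f x != 0) == (x \is a GRing.unit)] &&
  [forall x, forall y, f (x * y) == f x * f y].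

Record dirichlet_char (R : realType) (q : nat) := DirichletChar {
  dchar_val :> {ffun 'Z_q -> R[i]};
  _ : is_dirichlet_char dchar_val }.

HB.instance Definition _ (R : realType) (q : nat) :=
  [isSub for @dchar_val R q].
HB.instance Definition _ (R : realType) (q : nat) :=
  [Choice of dirichlet_char R q by <:].

Section DirichletCharGroup.
Variables (R : realType) (q : nat).
Implicit Types (f g : dirichlet_char R q) (x y : 'Z_q).

Lemma dchar_neq0 f x : (f x != 0) = (x \is a GRing.unit).
Proof. by case: f => f /= /andP[/forallP/(_ x)/eqP]. Qed.

Lemma dcharM f x y : f (x * y) = f x * f y.
Proof. by case: f => f /= /andP[_ /forallP/(_ x)/forallP/(_ y)/eqP]. Qed.

Fact dchar_mul_subproof f g : is_dirichlet_char [ffun x => f x * g x].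
Proof.
apply/andP; split; apply/forallP => x; last apply/forallP => y.
  by rewrite ffunE mulf_eq0 negb_or !dchar_neq0 andbb.
by rewrite !ffunE !dcharM mulrACA.
Qed.
Definition dchar_mul f g := DirichletChar (dchar_mul_subproof f g).

Fact dchar_one_subproof :
  is_dirichlet_char [ffun x : 'Z_q => (x \is a GRing.unit)%:R : R[i]].
Proof.
apply/andP; split; apply/forallP => x; last apply/forallP => y.
  by rewrite ffunE pnatr_eq0 eqb0 negbK.
by rewrite !ffunE unitrM -natrM mulnb.
Qed.
Definition dchar_one := DirichletChar dchar_one_subproof.

Fact dchar_inv_subproof f : is_dirichlet_char [ffun x => (f x)^-1].
Proof.
apply/andP; split; apply/forallP => x; last apply/forallP => y.
  by rewrite ffunE invr_eq0 dchar_neq0.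
by rewrite !ffunE dcharM invfM.
Qed.
Definition dchar_inv f := DirichletChar (dchar_inv_subproof f).

Fact dchar_mulA : associative dchar_mul.
Proof. by move=> f g h; apply/val_inj/ffunP => x; rewrite !ffunE mulrA. Qed.

Fact dchar_mul1 : left_id dchar_one dchar_mul.
Proof.
move=> f; apply/val_inj/ffunP => x; rewrite !ffunE -(dchar_neq0 f).
by case: eqP => [->|_]; rewrite ?mulr0 ?mul1r.
Qed.

Fact dchar_mulC : commutative dchar_mul.
Proof. by move=> f g; apply/val_inj/ffunP => x; rewrite !ffunE mulrC. Qed.

Fact dchar_mulr1 : right_id dchar_one dchar_mul.
Proof. by move=> f; rewrite dchar_mulC dchar_mul1. Qed.

Fact dchar_mulV : left_inverse dchar_one dchar_inv dchar_mul.
Proof.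
move=> f; apply/val_inj/ffunP => x; rewrite !ffunE -(dchar_neq0 f).
by case: eqP => [->|/eqP fx0]; rewrite ?mulr0 ?mulVf.
Qed.

Fact dchar_mulrV : right_inverse dchar_one dchar_inv dchar_mul.
Proof. by move=> f; rewrite dchar_mulC dchar_mulV. Qed.

HB.instance Definition _ := isGroup.Build (dirichlet_char R q)
  dchar_mulA dchar_mul1 dchar_mulr1 dchar_mulV dchar_mulrV.

End DirichletCharGroup.

Definition even_dchar (R : realType) (q : nat) (chi : dirichlet_char R q) :=
  chi (- 1) == 1.

(** [n ^ s = n ^ (Re s) * exp (i * Im s * ln n)], for [0 < n]. *)
Definition natCpow (R : realType) (n : nat) (s : R[i]) : R[i] :=
  (n%:R `^ complex.Re s)%:C *
  (cos (complex.Im s * ln n%:R) +i* sin (complex.Im s * ln n%:R)).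

(** The limit of partial sums, taken in the normed space [R[i]^o]; it is the
    value of the L-function when the series converges, in particular when
    [chi] is non-principal and [0 < Re s]. *)
Definition dirichlet_L (R : realType) (q : nat) (s : R[i])
    (chi : dirichlet_char R q) : R[i] :=
  limn (fun N : nat =>
    \sum_(1 <= n < N.+1) chi n%:R * natCpow n (- s) : R[i]^o).

(** The truncated iterated logarithm [log_nu], meant for [1 <= nu]. *)
Definition iterlog (R : realType) (nu : nat) (z : R) : R :=
  iter nu (fun x => Num.max 2 (ln x)) z.

(* Main.v *)
Require Import Defs.
From mathcomp Require Import fingroup finfield.
From mathcomp Require Import ring lra zify.

Set Implicit Arguments.
Unset Strict Implicit.
Unset Printing Implicit Defensive.

(** Let [G] be the group of characters in question, of order [H / 2]. The
    lower bound for the values of L at 1/2 comes from a first moment of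
    L(1/2, chi) over [G], weighted by the square of the modulus of a resonator
    R(chi), a character sum with nonnegative coefficients.

    For a non-principal [chi] the sum of [chi] over a period vanishes, so
    L(1/2, chi) is the sum over 0 < a < q of [chi a] times a kernel which
    lies between a^(-1/2) - q^(-1/2) and a^(-1/2) ([dirichlet_L_half],
    [kernel_ge], [kernel_le]). These coefficients are nonnegative, which is
    what makes a first moment useful. Multiply by the square of |R| and sum
    over [G]. By orthogonality only residues that agree modulo the
    annihilator of [G] interact, and by positivity all of these coincidences
    may be dropped except the true equalities n' = a n between integers of
    the support of the resonator. If |L(1/2, chi)| < V for all non-principal
    [chi] in [G], then the sum over a, n, n' = a n of f(n) f(n') kernel(a)
    is at most V times the energy (the sum of f(n)^2), plus the principal
    character's share ([resonance]). By Cauchy-Schwarz that share is at most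
    2 sqrt q |M| / |G| times the energy, [M] being the support; it is
    harmless as long as |M| <= H / sqrt q. Such a resonator therefore has
    [L = ln (H / sqrt q)] at its disposal, and the factors a are at most
    e^L <= sqrt q, where the kernel is at least a^(-1/2) / 2.

    It remains to find a support of at most e^L integers for which the sum of
    f(n) f(a n) / sqrt a exceeds the energy by the factor
    exp((sqrt 2 - o(1)) sqrt(L ln ln L / ln L)) ([resonator_exists]). The
    integers are products of p^m(p) over a finite set of primes, with exponents
    0, 1, 2, and coefficient the product of r(p) over the primes whose exponent
    differs from 1. The energy of all such integers is the product of
    1 + 2 r^2, and the sum of f(n) f(a n) / sqrt a the product of
    1 + 2 r^2 + 2 r / sqrt p, as an exponent may rise from 0 to 1 or from 1 to
    2. The gain is about the exponential of the sum of 2 r / sqrt p. With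
    exponents 0 and 1 only, the same budget for the expected number of primes
    with an unusual exponent would give a gain smaller by sqrt 2 in the
    exponent. The primes are split into blocks around (L / ln L) e^kappa, where
    kappa runs through a geometric progression of ratio close to 1 up to a
    small multiple of ln L. A choice of n primes in such a block costs about
    n kappa in ln |M|, and all blocks get the same share of [L]. The mass of
    a block in the sum of 1 / p comes from Mertens' first theorem
    ([mertens_interval]). Restricting to integers which have in each block
    at most slightly more than the expected number of unusual exponents
    loses only a constant factor, by Rankin's trick ([tail_bound]), and the
    same trick counts these integers ([card_resonator_set]).

    The characters of [G] are even because - 1 is a power with exponent
    (q - 1) / 2 modulo q, a multiple of the order of [G] ([subgroup_even]). *)

(** * Mertens' first theorem *)

Lemma prod_primes_dvd (m n N : nat) :
  (forall p, prime p -> (m <= p < n)%N -> (p %| N)%N) ->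
  (\prod_(m <= p < n | prime p) p %| N)%N.
Proof.
move=> H; apply/unstable.Gauss_dvd_prod => [|p]; last first.
  by rewrite mem_index_iota => pmn pp; apply: H.
rewrite map_id; set s := [seq _ <- _ | _].
have su : uniq s by rewrite filter_uniq ?iota_uniq.
have sp : {in s, forall p, prime p} by move=> p; rewrite mem_filter => /andP[].
elim: s su sp => //= x s IH /andP[xs us] sp; rewrite IH ?andbT//; last first.
  by move=> p ps; apply: sp; rewrite inE ps orbT.
apply/allP => y ys; rewrite prime_coprime ?sp ?mem_head//.
rewrite dvdn_prime2 ?sp ?mem_head// ?inE ?ys ?orbT//.
by apply: contraNneq xs => ->.
Qed.

Lemma bin_middle_le m : ('C(m.*2.+1, m) <= 4 ^ m)%N.
Proof.
have E := expnDn 1 1 m.*2.+1.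
have : ('C(m.*2.+1, m) + 'C(m.*2.+1, m.+1) <= 2 ^ m.*2.+1)%N.
  rewrite [X in (_ <= X)%N]E.
  under eq_bigr do rewrite !exp1n !muln1.
  have m1 : (m < m.*2.+2)%N by lia.
  have m2 : (m.+1 < m.*2.+2)%N by lia.
  rewrite (bigD1 (Ordinal m1)) //= (bigD1 (Ordinal m2)) /=; last first.
    by rewrite -val_eqE /=; lia.
  by rewrite addnA leq_addr.
have -> : 'C(m.*2.+1, m.+1) = 'C(m.*2.+1, m).
  by rewrite -(@bin_sub m.*2.+1 m); [congr 'C(_, _); lia | lia].
by rewrite addnn expnS -mul2n leq_mul2l /= -mul2n expnM.
Qed.

(** Primes in [m+2, 2m+1] divide the middle binomial coefficient of [2m+1],
    which is at most [4 ^ m]; the other primes are left to the induction. *)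
Lemma primorial_le n : (\prod_(0 <= p < n.+1 | prime p) p <= 4 ^ n)%N.
Proof.
elim/ltn_ind: n => n IH.
have [n3|n3] := ltnP n 3.
  by case: n n3 {IH} => [|[|[|//]]] _; rewrite unlock.
have [oddn|evenn] := boolP (odd n); last first.
  case: n n3 evenn IH => // n n3 evenn IH.
  rewrite big_mkcond big_nat_recr //= -big_mkcond /= ifN.
    by rewrite muln1 (leq_trans (IH _ _)) // leq_exp2l.
  by apply: contra evenn => /even_prime [pE|//]; rewrite pE in n3.
pose m := n./2; have nE : n = m.*2.+1 by rewrite -[n]odd_double_half oddn.
have m1 : (0 < m)%N by lia.
rewrite nE (@big_cat_nat _ _ _ m.+2) /=; try lia.
have -> : (4 ^ m.*2.+1 = 4 ^ m.+1 * 4 ^ m)%N by rewrite -expnD; congr expn; lia.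
apply: leq_mul; first by apply: IH; lia.
apply: leq_trans (bin_middle_le m); apply: dvdn_leq; first by rewrite bin_gt0; lia.
apply: prod_primes_dvd => p pp /andP[mp pm].
have : (p %| (m.*2.+1)`!)%N by rewrite dvdn_fact // prime_gt0 //; lia.
have pf k : (k < p)%N -> (p %| k`!)%N = false.
  move=> kp; apply/negbTE; elim: k kp => [|k IHk] kp.
    by rewrite fact0 Euclid_dvd1.
  by rewrite factS Euclid_dvdM // negb_or IHk ?gtnNdvd //; lia.
rewrite -(@bin_fact m.*2.+1 m); last by lia.
rewrite !Euclid_dvdM // !pf ?orbF //; lia.
Qed.

Section Mertens.
Variable R : realType.
Implicit Types (n p : nat) (x y : R).

Lemma lnM_nat m n : (0 < m)%N -> (0 < n)%N ->
  ln (m * n)%:R = ln m%:R + ln n%:R :> R.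
Proof. by move=> m0 n0; rewrite natrM lnM ?posrE ?ltr0n. Qed.

Lemma ln_prod_nat (r : seq nat) (P : pred nat) (F : nat -> nat) :
  (forall i, P i -> (0 < F i)%N) ->
  ln (\prod_(i <- r | P i) F i)%:R = \sum_(i <- r | P i) ln (F i)%:R :> R.
Proof.
move=> F0; elim: r => [|a r IH]; first by rewrite !big_nil ln1.
rewrite !big_cons; case: ifP => // Pa.
by rewrite lnM_nat ?F0 ?prodn_cond_gt0 // IH.
Qed.

Lemma ln_fact n :
  ln (n`!)%:R = \sum_(0 <= p < n.+1 | prime p) (logn p n`!)%:R * ln p%:R :> R.
Proof.
rewrite -{1}(partnT (fact_gt0 n)) (@widen_partn (maxn n`! n)) ?leq_maxl //.
rewrite ln_prod_nat => [|p _]; last first.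
  by case: p => [|p]; rewrite expn_gt0 // lognE eqxx orbT.
rewrite (@big_cat_nat _ _ _ n.+1) //=; last by rewrite ltnS leq_maxr.
rewrite [X in _ + X]big_nat_cond [X in _ + X]big1 ?addr0; last first.
  move=> p /andP[/andP[np _] _]; have [pp|npp] := boolP (prime p); last first.
    by rewrite lognE (negbTE npp) expn0 ln1.
  rewrite logn_fact // big_nat big1 ?expn0 ?ln1 // => i /andP[i1 _].
  rewrite divn_small // (leq_trans np) //; case: i i1 => // i _.
  by rewrite expnS leq_pmulr ?expn_gt0 ?prime_gt0.
rewrite [RHS]big_mkcond; apply: eq_big => // p _; case: ifPn => [pp|npp].
  by rewrite natrX lnXn ?ltr0n ?prime_gt0 // mulr_natl.
by rewrite lognE (negbTE npp) expn0 ln1.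
Qed.

Lemma ln_fact_sum n : ln (n`!)%:R = \sum_(1 <= i < n.+1) ln i%:R :> R.
Proof.
elim: n => [|n IH]; first by rewrite fact0 ln1 big_geq.
by rewrite factS lnM_nat ?fact_gt0 // big_nat_recr //= -IH addrC.
Qed.

Lemma ln_div_le (a b : R) : 0 < a -> 0 < b -> ln b - ln a <= b / a - 1.
Proof.
move=> a0 b0; rewrite -ln_div ?posrE //.
have := @le_ln1Dx R (b / a - 1); rewrite [1 + _]addrC subrK; apply.
have := divr_gt0 b0 a0; lra.
Qed.

Lemma ln_fact_le n : ln (n`!)%:R <= n%:R * ln n%:R :> R.
Proof.
case: n => [|n]; first by rewrite fact0 ln1 mul0r.
rewrite ln_fact_sum mulr_natl.
have -> : ln n.+1%:R *+ n.+1 = \sum_(1 <= i < n.+2) ln n.+1%:R :> R.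
  by rewrite sumr_const_nat subn1.
rewrite !big_nat; apply: ler_sum => i /andP[i1 i2].
by rewrite ler_ln ?posrE ?ltr0n // ler_nat.
Qed.

Lemma ln_fact_ge n : n%:R * ln n%:R - n%:R <= ln (n`!)%:R :> R.
Proof.
elim: n => [|n IH]; first by rewrite mul0r subr0 fact0 ln1.
rewrite factS lnM_nat ?fact_gt0 //.
case: n IH => [|n] IH; first by rewrite fact0 !ln1 mul1r; lra.
have := @ln_div_le n.+1%:R n.+2%:R; rewrite !ltr0n => /(_ isT isT) H.
have : n.+1%:R * (ln n.+2%:R - ln n.+1%:R) <= 1 :> R.
  have {}H := ler_wpM2l (ler0n R n.+1) H; apply: le_trans H _.
  by rewrite mulrBr mulrCA divff ?pnatr_eq0 // -[n.+2]addn1 natrD; lra.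
rewrite -[n.+2]addn1 natrD; lra.
Qed.

Definition mertens n : R := \sum_(0 <= p < n.+1 | prime p) ln p%:R / p%:R.

(** The right-hand side is chosen to telescope: its increment dominates the
    new term. As the series converges, the higher prime powers contribute only
    O(n) to [ln n`!]. *)
Lemma sum_ln_tail n : \sum_(2 <= m < n.+2) ln m%:R / (m%:R * (m%:R - 1)) <=
   2 - (2 + ln n.+1%:R) / n.+1%:R :> R.
Proof.
elim: n => [|n IH]; first by rewrite big_geq // ln1 addr0 divr1 subrr.
rewrite big_nat_recr //=; apply: le_trans (lerD IH (lexx _)) _.
have H := @ln_div_le n.+1%:R n.+2%:R (ltr0Sn _ _) (ltr0Sn _ _).
set a : R := n.+1%:R in H *; have a1 : 1 <= a by rewrite ler1n.
have a0 : a != 0 by rewrite gt_eqF; lra.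
have b1 : n.+2%:R = a + 1 by rewrite -[n.+2]addn1 natrD.
rewrite b1 in H *; rewrite addrK.
rewrite -lerBrDr; set la := ln a in H *; set lb := ln (a + 1) in H *.
have {}H : lb - la <= a^-1.
  by apply: le_trans H _; rewrite mulrDl divff // mul1r addrAC subrr add0r.
have {}H : (a + 1) * lb - (a + 1) * la <= 2.
  rewrite -mulrBr; have := ler_wpM2l _ H; move=> /(_ (a+1)).
  move=> H'; apply: le_trans (H' _) _; first lra.
  by rewrite mulrDl divff // mul1r lerD2l invf_le1; lra.
rewrite -subr_ge0.
have -> : 2 - (2 + lb) / (a + 1) - lb / ((a + 1) * a) - (2 - (2 + la) / a)
  = (2 + (a+1) * la - (a+1) * lb) / (a * (a + 1)).
  by field; rewrite !gt_eqF; lra.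
by apply: divr_ge0; [lra|apply: mulr_ge0; lra].
Qed.

Lemma logn_fact_le p n : prime p ->
  (logn p n`!)%:R <= n%:R / p%:R + n%:R / (p%:R * (p%:R - 1)) :> R.
Proof.
move=> pp; have p2 : 2 <= p%:R :> R by rewrite ler_nat prime_gt1.
rewrite logn_fact // natr_sum.
have G m : \sum_(1 <= k < m.+1) (p%:R ^+ k)^-1 = (1 - (p%:R ^+ m)^-1) / (p%:R - 1) :> R.
  elim: m => [|m IH]; first by rewrite big_geq // expr0 invr1 subrr mul0r.
  rewrite big_nat_recr //= IH exprS invfM.
  by field; rewrite expf_neq0 ?gt_eqF; lra.
apply: (@le_trans _ _ (n%:R * \sum_(1 <= k < n.+1) (p%:R ^+ k)^-1)).
  rewrite mulr_sumr; apply: ler_sum => k _.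
  rewrite ler_pdivlMr ?exprn_gt0; [|lra|lra].
  by rewrite -natrX -natrM ler_nat leq_divM.
rewrite G -mulrDr ler_wpM2l //.
have -> : p%:R^-1 + (p%:R * (p%:R - 1))^-1 = (p%:R - 1)^-1 :> R.
  by field; rewrite !gt_eqF; lra.
rewrite ler_pdivrMr; last lra.
rewrite mulVf; last by rewrite gt_eqF; lra.
by rewrite gerBl invr_ge0 exprn_ge0; lra.
Qed.

(** Legendre's formula writes [ln n`!] as a sum over primes in which [p] has
    the coefficient [n / p], up to higher powers of [p] and rounding; compare
    with [ln n`! = n ln n + O(n)]. *)
Lemma mertens_ge n : (0 < n)%N -> ln n%:R - 3 <= mertens n.
Proof.
move=> n0; have n0' : 0 < n%:R :> R by rewrite ltr0n.
rewrite -(ler_pM2l n0').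
have : ln (n`!)%:R <= n%:R * mertens n + n%:R * 2 :> R.
  rewrite ln_fact.
  have Hp : \sum_(0 <= p < n.+1 | prime p) ln p%:R / (p%:R * (p%:R - 1)) <= 2 :> R.
    apply: (@le_trans _ _ (\sum_(0 <= m < n.+2)
        (if prime m then ln m%:R / (m%:R * (m%:R - 1)) else 0 : R))).
      rewrite [leRHS]big_nat_recr //= -big_mkcond /= lerDl; case: ifP => // /prime_gt1 p1.
      by rewrite mulr_ge0 ?ln_ge0 ?ler1n // invr_ge0 mulr_ge0 // subr_ge0 ler1n.
    rewrite (@big_cat_nat _ _ _ 2) //= [X in X + _](_ : _ = 0) ?add0r; last by rewrite unlock /=; lra.
    apply: (@le_trans _ _ (\sum_(2 <= m < n.+2) ln m%:R / (m%:R * (m%:R - 1)))).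
      rewrite !big_nat; apply: ler_sum => m /andP[m2 _]; case: ifP => // _.
      by rewrite mulr_ge0 ?ln_ge0 ?ler1n ?(ltnW m2) // invr_ge0 mulr_ge0 // subr_ge0 ler1n ltnW.
    apply: le_trans (sum_ln_tail n) _.
    by rewrite gerBl divr_ge0 // addr_ge0 ?ln_ge0 // ler1n.
  apply: (@le_trans _ _ (n%:R * mertens n + n%:R *
      \sum_(0 <= p < n.+1 | prime p) ln p%:R / (p%:R * (p%:R - 1)))); last first.
    by rewrite lerD2l ler_pM2l.
  rewrite /mertens -mulrDr -big_split mulr_sumr /=; apply: ler_sum => p pp.
  have lp : 0 <= ln p%:R :> R by rewrite ln_ge0 // ler1n prime_gt0.
  apply: le_trans (ler_wpM2r lp (logn_fact_le n pp)) _.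
  by rewrite le_eqVlt; apply/orP; left; apply/eqP; ring.
have := ln_fact_ge n; rewrite mulrBr; lra.
Qed.

Lemma theta_le n : \sum_(0 <= p < n.+1 | prime p) ln p%:R <= n%:R * 2 :> R.
Proof.
rewrite -(@ln_prod_nat _ prime id) => [|p /prime_gt0//].
apply: (@le_trans _ _ (ln (4 ^ n)%:R)).
  rewrite ler_ln ?posrE ?ltr0n ?expn_gt0 //; last by rewrite prodn_cond_gt0 // => p /prime_gt0.
  by rewrite ler_nat primorial_le.
rewrite natrX lnXn // -[leLHS]mulr_natl ler_wpM2l //.
have -> : 4 = 2 * 2 :> R by rewrite -natrM.
rewrite lnM ?posrE //; have := @ln_div_le 1 2; rewrite ln1; lra.
Qed.

(** The rounding in [n %/ p] costs at most [ln p] for each prime, in total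
    the logarithm of the primorial. *)
Lemma mertens_le n : (0 < n)%N -> mertens n <= ln n%:R + 2.
Proof.
move=> n0; have n0' : 0 < n%:R :> R by rewrite ltr0n.
rewrite -(ler_pM2l n0').
suff : n%:R * mertens n - n%:R * 2 <= ln (n`!)%:R :> R by have := ln_fact_le n; rewrite mulrDr; lra.
apply: (@le_trans _ _ (n%:R * mertens n - \sum_(0 <= p < n.+1 | prime p) ln p%:R)).
  by rewrite lerD2l lerN2 theta_le.
rewrite ln_fact /mertens mulr_sumr -sumrB; apply: ler_sum => p pp.
have lp : 0 <= ln p%:R :> R by rewrite ln_ge0 // ler1n prime_gt0.
have p0 : 0 < p%:R :> R by rewrite ltr0n prime_gt0.
have -> : n%:R * (ln p%:R / p%:R) - ln p%:R = (n%:R / p%:R - 1) * ln p%:R :> R by ring.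
rewrite ler_wpM2r //.
have : (n %/ p <= logn p n`!)%N.
  by rewrite logn_fact // big_nat_recl // expn1 leq_addr.
rewrite -(ler_nat R); apply: le_trans.
rewrite lerBlDr natr1 ler_pdivrMr // -natrM ler_nat.
by have := ltn_ceil n (prime_gt0 pp); lia.
Qed.

(** The errors in [mertens_ge] and [mertens_le] are absolute constants, so
    this has the right order as soon as [ln y - ln x] is large, even where it
    is much smaller than [ln x]. *)
Lemma mertens_interval x y : 1 <= x -> x <= y ->
  ln y - ln x - 6 <=
  \sum_(0 <= p < (Num.truncn y).+1 | prime p && (x < p%:R)) ln p%:R / p%:R.
Proof.
move=> x1 xy; set n := Num.truncn y; set m := Num.truncn x.
have y0 : 0 <= y by lra.
have mn : (m <= n)%N by rewrite le_truncn.
have m0 : (0 < m)%N by rewrite truncn_gt0.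
have n0 : (0 < n)%N by apply: leq_trans mn.
have -> : \sum_(0 <= p < n.+1 | prime p && (x < p%:R)) ln p%:R / p%:R =
    mertens n - mertens m.
  rewrite /mertens [X in _ = X - _](@big_cat_nat _ _ _ m.+1) //= addrAC subrr add0r.
  rewrite (@big_cat_nat _ _ _ m.+1) //= [X in X + _]big_nat_cond.
  rewrite [X in X + _]big1 ?add0r; last first.
    move=> p /andP[/andP[_ pm] /andP[_]]; rewrite ltNge => /negP; case.
    by apply: le_trans (_ : m%:R <= x); [rewrite ler_nat|rewrite truncn_le; lra].
  rewrite big_nat_cond [RHS]big_nat_cond; apply: eq_bigl => p.
  case mp : (m < p)%N => //=; case: (p < _)%N => //=; case: (prime p) => //=.
  by apply: lt_le_trans (truncnS_gt x) _; rewrite ler_nat.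
have := mertens_ge n0; have := mertens_le m0.
have : ln m%:R <= ln x.
  rewrite ler_ln ?posrE ?ltr0n //; last lra.
  by rewrite truncn_le; lra.
have := @ln_div_le n%:R y; rewrite ltr0n n0 => /(_ isT).
have yn : y < n%:R + 1 by rewrite natr1 truncnS_gt.
have n1 : 1 <= n%:R :> R by rewrite ler1n.
have : y / n%:R <= 2 by rewrite ler_pdivrMr; lra.
move=> h1 h2; have {}h2 := h2 ltac:(lra); lra.
Qed.

End Mertens.

(** * Multiplicative resonators with exponents 0, 1, 2 *)

Definition invsqrt (R : realType) (n : nat) : R := (Num.sqrt n%:R)^-1.

Lemma invsqrt_ge0 (R : realType) n : 0 <= invsqrt R n.
Proof. by rewrite invr_ge0 sqrtr_ge0. Qed.

(** The exponent pattern [m] stands for the product of the [pr p ^ m p]. A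
    move is a pattern together with the set of primes whose exponent goes up
    by one; it encodes an equality n' = a n, with [a] squarefree. All sums over
    moves or patterns factor over the primes, which is the point of this
    encoding. A step that would lead to the exponent 3 gets weight zero. *)
Section Resonator.
Variables (R : realType) (P : finType) (pr : P -> nat) (B : nat) (b : P -> 'I_B).
Variables (r : P -> R) (nu : 'I_B -> R).
Hypothesis pr_prime : forall p, prime (pr p).
Hypothesis pr_inj : injective pr.
Hypothesis r_ge0 : forall p, 0 <= r p.

Let state := {ffun P -> 'I_3}.
Let step : Type := 'I_3 * bool.
Let move := {ffun P -> step}.
Implicit Types (m : state) (F : move) (p : P) (s : step) (j : 'I_B) (t : 'I_3).

(** The exponent 1 is the ground state and 0 and 2 are the excited ones, so
    that a rise by one, from 0 or from 1, always has exactly one excited end. *)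
Definition excited t : bool := t != 1 :> nat.
Definition amplitude (x : R) t : R := if excited t then x else 1.
Definition target s : 'I_3 := inord (s.1 + s.2)%N.
Definition step_ok s : bool := (s.1 + s.2 < 3)%N.
Definition step_weight (x c : R) s : R :=
  amplitude x s.1 * amplitude x (target s) * (if s.2 then c else 1) * (step_ok s)%:R.

Lemma sum_step (G : step -> R) : (forall t, G (t, true) = G (t, true) * (t < 2)%N%:R) ->
  \sum_s G s = G (inord 0, false) + G (inord 1, false) + G (inord 2, false) +
     G (inord 0, true) + G (inord 1, true).
Proof.
move=> G2.
rewrite (eq_bigr (fun s => G (s.1, s.2))) => [|[]//].
rewrite -(pair_bigA _ (fun t c => G (t, c))) /=.
rewrite !big_ord_recl big_ord0 !big_bool /=.
have E0 : ord0 = inord 0 :> 'I_3 by apply/val_inj; rewrite /= inordK.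
have E1 : lift ord0 ord0 = inord 1 :> 'I_3 by apply/val_inj; rewrite /= inordK.
have E2 : lift ord0 (lift ord0 ord0) = inord 2 :> 'I_3 by apply/val_inj; rewrite /= inordK.
rewrite E2 E1 E0 (G2 (inord 2)) inordK // mulr0; ring.
Qed.

(** The weights [u], [v], [w] mark an excited source, an excited destination
    and a rise. Powers of them are inserted to bound tails. *)
Definition bonus (u v w : R) s : R :=
  (if excited s.1 then u else 1) * (if excited (target s) then v else 1) * (if s.2 then w else 1).

Lemma sum_step_weight (x c u v w : R) :
  \sum_s step_weight x c s * bonus u v w s =
  1 + 2 * (u * v) * x ^+ 2 + (u + v) * w * x * c.
Proof.
rewrite sum_step => [|t]; last first.
  rewrite /step_weight /step_ok /= addn1 ltnS.
  by case: (t < 2)%N; rewrite ?mulr1 // ?mulr0 ?mul0r.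
rewrite /step_weight /bonus /step_ok /target /amplitude /excited /= !inordK //=.
ring.
Qed.

Notation invsqrt := (invsqrt R).
Let c p := invsqrt (pr p).
Definition move_weight F := \prod_p step_weight (r p) (c p) (F p).
Definition source F : state := [ffun p => (F p).1].
Definition destination F : state := [ffun p => target (F p)].
(** The total weight of all moves, see [sum_move_weight1]. *)
Definition full : R := \prod_p (1 + 2 * r p ^+ 2 + 2 * r p * c p).
Definition excitation j m := #|[pred p | (b p == j) && excited (m p)]|.
Definition move_size F := #|[pred p | (F p).2]|.
(** To first order, the expected number of excited primes in block [j], and
    below that, the expected number of rises there. *)
Definition mass j := \sum_(p | b p == j) 2 * r p ^+ 2.
Definition gain j := \sum_(p | b p == j) 2 * r p * c p.
Definition total_gain := \sum_p 2 * r p * c p.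

Let c_ge0 p : 0 <= c p. Proof. exact: invsqrt_ge0. Qed.

Lemma amplitude_ge0 x t : 0 <= x -> 0 <= amplitude x t.
Proof. by rewrite /amplitude; case: ifP. Qed.

Lemma step_weight_ge0 x d s : 0 <= x -> 0 <= d -> 0 <= step_weight x d s.
Proof.
by move=> x0 d0; rewrite !mulr_ge0 ?amplitude_ge0 ?ler0n //; case: ifP.
Qed.

Lemma move_weight_ge0 F : 0 <= move_weight F.
Proof. by apply: prodr_ge0 => p _; apply: step_weight_ge0. Qed.

Lemma sum_move_weight (u v w : P -> R) :
  \sum_F move_weight F * \prod_p bonus (u p) (v p) (w p) (F p) =
  \prod_p (1 + 2 * (u p * v p) * r p ^+ 2 + (u p + v p) * w p * r p * c p).
Proof.
under [RHS]eq_bigr do rewrite -sum_step_weight.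
by rewrite bigA_distr_bigA; apply: eq_bigr => F _; rewrite -big_split.
Qed.

Lemma prod_if (A : pred P) (x : R) : \prod_p (if A p then x else 1) = x ^+ #|[pred p | A p]|.
Proof. by rewrite -big_mkcond /= -prodr_const; exact: eq_bigl. Qed.

Lemma sum_move_weight1 : \sum_F move_weight F = full.
Proof.
have := sum_move_weight (fun=> 1) (fun=> 1) (fun=> 1).
rewrite (eq_bigr move_weight) => [->|F _].
  by apply: eq_bigr => p _; rewrite !mulr1.
by rewrite big1 ?mulr1 // => p _; rewrite /bonus !if_same !mulr1.
Qed.

Lemma full_gt0 : 0 < full.
Proof.
apply: prodr_gt0 => p _; have := mulr_ge0 (r_ge0 p) (c_ge0 p); have := sqr_ge0 (r p).
rewrite -mulrA; lra.
Qed.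

(** Tilting the excited states of one prime by [l] multiplies its factor by
    at most [exp((l - 1) D)], where [D] is the first-order probability that
    the source (or the destination) is excited. *)
Lemma tilt_le (x d l : R) (A : bool) : 0 <= x -> 0 <= d -> 1 <= l ->
  1 + 2 * (if A then l else 1) * x ^+ 2 + ((if A then l else 1) + 1) * x * d <=
  (1 + 2 * x ^+ 2 + 2 * x * d) * expR (if A then (l - 1) * (2 * x ^+ 2 + (2 * x * d) / 2) else 0).
Proof.
move=> x0 d0 l1; case: A; last by rewrite expR0; lra.
have x2 := sqr_ge0 x; have xd := mulr_ge0 x0 d0.
set D := 2 * x ^+ 2 + 2 * x * d / 2.
have D0 : 0 <= D by rewrite /D; nra.
have e : 1 + (l - 1) * D <= expR ((l - 1) * D) by exact: expR_ge1Dx.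
have lD : 0 <= (l - 1) * D by rewrite mulr_ge0 // subr_ge0.
apply: le_trans (_ : (1 + 2 * x ^+ 2 + 2 * x * d) * (1 + (l - 1) * D) <= _); last first.
  by rewrite ler_wpM2l //; nra.
have : 0 <= (2 * x ^+ 2 + 2 * x * d) * ((l - 1) * D).
  by rewrite mulr_ge0 //; nra.
rewrite /D; nra.
Qed.

(** Rankin's trick: insert [exp(tau (excitation - nu))], which is at least 1
    on the tail, and sum over all moves. The source and the destination have
    the same law. *)
Lemma tail_bound (h : move -> state) j (tau : R) :
  h = source \/ h = destination -> 0 <= tau ->
  \sum_(F | ~~ ((excitation j (h F))%:R <= nu j)) move_weight F <=
  full * expR ((expR tau - 1) * (mass j + gain j / 2) - tau * nu j).
Proof.
move=> hE t0; set l := expR tau; have l1 : 1 <= l by rewrite -expR0 ler_expR.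
pose u p := if b p == j then l else 1.
have E : \sum_F move_weight F * l ^+ excitation j (h F) =
  \prod_p (1 + 2 * u p * r p ^+ 2 + (u p + 1) * r p * c p).
  case: hE => ->.
  - have := sum_move_weight u (fun=> 1) (fun=> 1).
    rewrite (eq_bigr (fun F => move_weight F * l ^+ excitation j (source F))) => [->|F _].
      by apply: eq_bigr => p _; rewrite !mulr1.
    congr (_ * _); rewrite -prod_if; apply: eq_bigr => p _.
    by rewrite /bonus /u !if_same !mulr1 ffunE; case: (b p == j); case: (excited _).
  - have := sum_move_weight (fun=> 1) u (fun=> 1).
    rewrite (eq_bigr (fun F => move_weight F * l ^+ excitation j (destination F))) => [->|F _].
      by apply: eq_bigr => p _; ring.
    congr (_ * _); rewrite -prod_if; apply: eq_bigr => p _.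
    by rewrite /bonus /u !if_same !mulr1 mul1r ffunE; case: (b p == j); case: (excited _).
apply: (@le_trans _ _ (\sum_F (move_weight F * l ^+ excitation j (h F)) * expR (- (tau * nu j)))).
  rewrite big_mkcond; apply: ler_sum => F _; case: ifPn => [H|_]; last first.
    by rewrite !mulr_ge0 ?move_weight_ge0 ?exprn_ge0 ?expR_ge0.
  rewrite -[leLHS]mulr1 -mulrA ler_wpM2l ?move_weight_ge0 // /l -expRM_natr -expRD.
  rewrite -[leLHS]expR0 ler_expR -mulrN -mulrDr mulr_ge0 // subr_ge0 ltW // ltNge //.
rewrite -mulr_suml E expRD mulrA ler_wpM2r ?expR_ge0 //.
have -> : expR ((l - 1) * (mass j + gain j / 2)) =
  \prod_p expR (if b p == j then (l - 1) * (2 * r p ^+ 2 + (2 * r p * c p) / 2) else 0).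
  rewrite -expR_sum -big_mkcond -mulr_sumr big_split /= /mass /gain mulr_suml //.
rewrite /full -big_split; apply: ler_prod => p _; rewrite /u tilt_le ?andbT //.
have := sqr_ge0 (r p); have := mulr_ge0 (r_ge0 p) (c_ge0 p).
by case: (b p == j); move=> h1 h2; rewrite addr_ge0 ?addr_ge0 ?mulr_ge0 //; lra.
Qed.

(** Rankin's trick again, with the tilt 2 for each rise. *)
Lemma size_tail_bound (y : R) :
  \sum_(F | ~~ ((move_size F)%:R <= y)) move_weight F <=
  full * expR (total_gain - y / 2).
Proof.
have E : \sum_F move_weight F * 2 ^+ move_size F =
  \prod_p (1 + 2 * r p ^+ 2 + 4 * r p * c p).
  have := sum_move_weight (fun=> 1) (fun=> 1) (fun=> 2).
  rewrite (eq_bigr (fun F => move_weight F * 2 ^+ move_size F)) => [->|F _].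
    by apply: eq_bigr => p _; ring.
  congr (_ * _); rewrite -prod_if; apply: eq_bigr => p _.
  by rewrite /bonus !if_same !mul1r.
have ln2 : 1 / 2 <= ln (2 : R) by have := @ln_div_le R 2 1; rewrite ln1; lra.
apply: (@le_trans _ _ (\sum_F (move_weight F * 2 ^+ move_size F) * expR (- (y / 2)))).
  rewrite big_mkcond; apply: ler_sum => F _; case: ifPn => [H|_]; last first.
    by rewrite !mulr_ge0 ?move_weight_ge0 ?exprn_ge0 ?expR_ge0.
  rewrite -[leLHS]mulr1 -mulrA ler_wpM2l ?move_weight_ge0 //.
  rewrite -{1}[2]lnK ?posrE // -expRM_natr -expRD -[leLHS]expR0 ler_expR.
  rewrite -ltNge in H; have := ler_wpM2r (ler0n R (move_size F)) ln2; lra.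
rewrite -mulr_suml E expRD mulrA ler_wpM2r ?expR_ge0 //.
rewrite /total_gain expR_sum /full -big_split; apply: ler_prod => p _ /=.
have h1 := sqr_ge0 (r p); have := mulr_ge0 (r_ge0 p) (c_ge0 p).
rewrite -!mulrA; set t := r p * c p => t0; apply/andP; split; first lra.
have : 1 + 2 * t <= expR (2 * t) by exact: expR_ge1Dx.
move=> /(ler_wpM2l (_ : 0 <= 1 + 2 * r p ^+ 2 + 2 * t)) H.
apply: le_trans (H _); last lra.
nra.
Qed.

Definition resonator_set : {set state} :=
  finset (fun m => [forall j, (excitation j m)%:R <= nu j]).
Definition coefficient m : R := \prod_p amplitude (r p) (m p).
Definition integer m : nat := (\prod_p pr p ^ m p)%N.

(** Union bound over the blocks, for the sources and for the destinations. *)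
Lemma good_moves_bound (tau y : R) : 0 <= tau ->
  full * (1 - (\sum_j 2 * expR ((expR tau - 1) * (mass j + gain j / 2) - tau * nu j))
    - expR (total_gain - y / 2)) <=
  \sum_(F | [&& source F \in resonator_set, destination F \in resonator_set &
     (move_size F)%:R <= y]) move_weight F.
Proof.
move=> tau0.
pose bad (h : move -> state) j F := ~~ ((excitation j (h F))%:R <= nu j).
apply: (@le_trans _ _ (\sum_F (move_weight F *
  (1 - \sum_j ((bad source j F)%:R + (bad destination j F)%:R) - (~~ ((move_size F)%:R <= y))%:R)))).
  under [leRHS]eq_bigr do rewrite 2!mulrBr mulr1.
  rewrite !big_split /= !sumrN sum_move_weight1 !mulrBr mulr1 -!addrA lerD2l.
  apply: lerD; rewrite lerN2.
    under [leLHS]eq_bigr do rewrite mulr_sumr.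
    rewrite exchange_big /= mulr_sumr.
    apply: ler_sum => j _; under [leLHS]eq_bigr do rewrite mulrDr.
    have T h : h = source \/ h = destination -> \sum_F move_weight F * (bad h j F)%:R <=
       full * expR ((expR tau - 1) * (mass j + gain j / 2) - tau * nu j).
      move=> hE; have := @tail_bound h j tau hE tau0; apply: le_trans.
      by rewrite [leRHS]big_mkcond; apply: ler_sum => F _; rewrite /bad;
        case: ifP; rewrite ?mulr1 ?mulr0.
    rewrite big_split /= mulrCA mulr_natl mulr2n; apply: lerD; apply: T; [left|right]; done.
  apply: le_trans (size_tail_bound y).
  by rewrite [leRHS]big_mkcond; apply: ler_sum => F _; case: ifP; rewrite ?mulr1 ?mulr0.
rewrite [leRHS]big_mkcond; apply: ler_sum => F _.
have s0 h : 0 <= \sum_j (bad h j F)%:R :> R by apply: sumr_ge0.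
have sb h : h F \notin resonator_set -> 1 <= \sum_j (bad h j F)%:R :> R.
  rewrite inE => /forallPn[j hj]; rewrite (bigD1 j) //= /bad hj lerDl.
  by apply: sumr_ge0.
rewrite big_split /=; have := s0 source; have := s0 destination.
case: ifPn => [_ H1 H2|].
  rewrite -[leRHS]mulr1 ler_wpM2l ?move_weight_ge0 //.
  by have : 0 <= (~~ ((move_size F)%:R <= y))%:R :> R := ler0n _ _; lra.
rewrite !negb_and => H H1 H2; rewrite -oppr_ge0 -mulrN mulr_ge0 ?move_weight_ge0 //.
case/or3P: H => [/sb|/sb|->] /=; try lra.
  by have : 0 <= (~~ ((move_size F)%:R <= y))%:R :> R := ler0n _ _; lra.
by have : 0 <= (~~ ((move_size F)%:R <= y))%:R :> R := ler0n _ _; lra.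
Qed.

(** At each prime, [1 + D + t >= (1 + D) exp((1 - eta) t)] where
    [D = 2 r ^ 2] and [t = 2 r / sqrt p], provided that [D + t <= eta]. The
    left factor of the claim is the energy of the untruncated resonator. *)
Lemma full_ge (eta : R) : 0 <= eta ->
  (forall p, 2 * r p ^+ 2 + 2 * r p * c p <= eta) ->
  (\sum_m coefficient m ^+ 2) * expR ((1 - eta) * total_gain) <= full.
Proof.
move=> eta0 small.
have -> : \sum_m coefficient m ^+ 2 = \prod_p (1 + 2 * r p ^+ 2).
  transitivity (\prod_p \sum_t amplitude (r p) t ^+ 2).
    rewrite bigA_distr_bigA; apply: eq_bigr => m _.
    by rewrite -prodrXl.
  apply: eq_bigr => p _; rewrite !big_ord_recl big_ord0 /amplitude /excited /=; ring.
rewrite /total_gain mulr_sumr expR_sum -big_split; apply: ler_prod => p _ /=.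
have h1 := sqr_ge0 (r p); have := mulr_ge0 (r_ge0 p) (c_ge0 p).
have := small p; rewrite -!mulrA; set D := 2 * r p ^+ 2; set t := 2 * (r p * c p).
move=> Dt rc0; have D0 : 0 <= D by rewrite /D; lra.
have t0 : 0 <= t by rewrite /t; lra.
have D1 : 0 <= 1 + D by lra.
rewrite mulr_ge0 ?expR_ge0 //=.
have := @expR_ge1Dx R (- ((1 - eta) * t)); set e := expR ((1 - eta) * t).
have e0 : 0 < e by exact: expR_gt0.
rewrite expRN -/e => H.
have {}H : (1 - (1 - eta) * t) * e <= 1.
  by rewrite -(ler_pdivlMr _ _ e0) div1r; lra.
have eta1 : (1 - eta) * (1 + D + t) <= 1 by nra.
apply: (@le_trans _ _ ((1 + D + t) * (1 - (1 - eta) * t) * e)).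
  apply: ler_wpM2r; first exact: ltW.
  have := ler_wpM2l t0 eta1; nra.
rewrite -mulrA -[leRHS]mulr1 ler_wpM2l //; lra.
Qed.

(** Rankin's trick for counting: weigh an excited prime of block [j] by
    [exp(- kappa j)] and compensate by [exp(nu j * kappa j)]. The sum over all
    patterns is a product over primes of [1 + 2 exp(- kappa)]. *)
Lemma card_resonator_set (kappa : 'I_B -> R) : (forall j, 0 <= kappa j) ->
  #|resonator_set|%:R <=
  expR (\sum_j (nu j * kappa j + 2 * expR (- kappa j) * #|[pred p | b p == j]|%:R)).
Proof.
move=> k0; rewrite big_split expRD /=.
pose tilt m : R := expR (\sum_j nu j * kappa j) *
   \prod_p (if excited (m p) then expR (- kappa (b p)) else 1).
apply: (@le_trans _ _ (\sum_m tilt m)).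
  rewrite -sum1_card natr_sum big_mkcond; apply: ler_sum => m _; rewrite /tilt.
  case: ifPn => [|_]; last first.
    by rewrite mulr_ge0 ?expR_ge0 // prodr_ge0 // => p _; case: ifP; rewrite ?expR_ge0.
  rewrite inE => /forallP mM.
  have -> : \prod_p (if excited (m p) then expR (- kappa (b p)) else 1) =
     expR (- \sum_j (excitation j m)%:R * kappa j).
    rewrite -sumrN expR_sum.
    transitivity (\prod_p \prod_j (if (b p == j) && excited (m p) then expR (- kappa j) else 1)).
      apply: eq_bigr => p _; rewrite (bigD1 (b p)) //= eqxx /= big1 ?mulr1 // => j.
      by rewrite eq_sym => /negbTE ->.
    rewrite exchange_big; apply: eq_bigr => j _.
    by rewrite prod_if -mulrN mulrC expRM_natr.
  rewrite -expRD -[leLHS]expR0 ler_expR subr_ge0; apply: ler_sum => j _.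
  by rewrite ler_wpM2r.
rewrite -mulr_sumr ler_wpM2l ?expR_ge0 //.
rewrite -(bigA_distr_bigA (fun p t => if excited t then expR (- kappa (b p)) else 1)).
have -> : \sum_j 2 * expR (- kappa j) * #|[pred p | b p == j]|%:R = \sum_p 2 * expR (- kappa (b p)).
  rewrite [RHS](partition_big b xpredT) //=; apply: eq_bigr => j _.
  rewrite (eq_bigr (fun=> 2 * expR (- kappa j))) => [|p /eqP -> //].
  by rewrite sumr_const mulr_natr.
rewrite expR_sum; apply: ler_prod => p _.
rewrite sumr_ge0 => [|t _]; last by case: ifP; rewrite ?expR_ge0.
rewrite !big_ord_recl big_ord0 /excited /=.
apply: le_trans (expR_ge1Dx _); rewrite addr0; lra.
Qed.

Definition multiplier F : nat := (\prod_(p | (F p).2) pr p)%N.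

Lemma pr_gt0 p : (0 < pr p)%N. Proof. exact: prime_gt0. Qed.

Lemma multiplier_gt0 F : (0 < multiplier F)%N.
Proof. by apply: prodn_gt0 => p; apply: pr_gt0. Qed.

Lemma logn_integer m p : logn (pr p) (integer m) = m p.
Proof.
rewrite /integer (bigD1 p) //= lognM ?expn_gt0 ?pr_gt0 //; last first.
  by apply: prodn_gt0 => i; rewrite expn_gt0 pr_gt0.
rewrite pfactorK // logn_coprime ?addn0 //.
elim/big_ind: _ => [|a d ha hd|i ip]; rewrite ?coprimen1 ?coprimeMr ?ha ?hd //.
rewrite coprimeXr // prime_coprime // dvdn_prime2 //.
by apply: contra ip => /eqP /pr_inj ->.
Qed.

Lemma integer_inj : injective integer.
Proof. by move=> m m' E; apply/ffunP => p; apply: val_inj; rewrite /= -!logn_integer E. Qed.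

Lemma integer_coprime m q : prime q -> (forall p, (pr p < q)%N) -> coprime q (integer m).
Proof.
move=> pq lt_q; rewrite /integer.
elim/big_ind: _ => [|a d ha hd|p _]; rewrite ?coprimen1 ?coprimeMr ?ha ?hd //.
rewrite coprimeXr // prime_coprime // dvdn_prime2 //.
by have := lt_q p; rewrite ltn_neqAle eq_sym => /andP[].
Qed.

Lemma invsqrtM (m n : nat) : invsqrt (m * n) = invsqrt m * invsqrt n.
Proof. by rewrite /invsqrt natrM sqrtrM // invfM. Qed.

Lemma move_ok F : move_weight F != 0 -> forall p, step_ok (F p).
Proof.
move=> nz p; apply: contraNT nz => nok.
by rewrite /move_weight (bigD1 p) //= /step_weight (negbTE nok) mulr0 mul0r.
Qed.

Lemma integer_destination F : (forall p, step_ok (F p)) ->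
  integer (destination F) = (multiplier F * integer (source F))%N.
Proof.
move=> ok; rewrite /integer /multiplier [X in (X * _)%N]big_mkcond -big_split; apply: eq_bigr => p _ /=.
rewrite !ffunE /target inordK; last exact: ok.
by rewrite expnD mulnC; case: (F p).2.
Qed.

Lemma move_weight_ok F : (forall p, step_ok (F p)) ->
  move_weight F =
  coefficient (source F) * coefficient (destination F) * invsqrt (multiplier F).
Proof.
move=> ok; rewrite /move_weight /coefficient /multiplier.
have -> : invsqrt (\prod_(p | (F p).2) pr p) = \prod_p (if (F p).2 then c p else 1).
  rewrite -big_mkcond /=; elim/big_ind2: _ => [|x m x' m' <- <-|//].
    by rewrite /invsqrt sqrtr1 invr1.
  by rewrite invsqrtM.
rewrite -!big_split; apply: eq_bigr => p _ /=.
by rewrite !ffunE /step_weight ok mulr1.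
Qed.

Lemma coefficient_ge0 m : 0 <= coefficient m.
Proof. by apply: prodr_ge0 => p _; apply: amplitude_ge0. Qed.

(** A legal move [F] accounts for the pair of integers at its source and its
    destination with [a = multiplier F]. Different legal moves have different
    pairs of source and destination, so no term on the right is used twice. *)
Lemma sum_move_weight_le (y : R) (A : nat) :
  (forall F, (move_size F)%:R <= y -> (multiplier F <= A)%N) ->
  \sum_(F | [&& source F \in resonator_set, destination F \in resonator_set &
     (move_size F)%:R <= y]) move_weight F <=
  \sum_(1 <= a < A.+1) invsqrt a *
    \sum_(m in resonator_set) \sum_(m' in resonator_set | integer m' == (a * integer m)%N)
       coefficient m * coefficient m'.
Proof.
move=> hA.
pose G (mm : state * state) : R := \sum_(1 <= a < A.+1)
  invsqrt a * ((integer mm.2 == (a * integer mm.1)%N)%:R * (coefficient mm.1 * coefficient mm.2)).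
have G0 mm : 0 <= G mm.
  by apply: sumr_ge0 => a _; rewrite !mulr_ge0 ?invsqrt_ge0 ?ler0n ?coefficient_ge0.
pose h F := (source F, destination F).
pose D := finset (fun F => [&& source F \in resonator_set, destination F \in resonator_set,
     (move_size F)%:R <= y & [forall p, step_ok (F p)]]).
have hinj : {in D &, injective h}.
  move=> F F'; rewrite !inE => /and4P[_ _ _ /forallP ok] /and4P[_ _ _ /forallP ok'] [E1 E2].
  apply/ffunP => p; have /ffunP/(_ p) := E1; have /ffunP/(_ p) := E2.
  rewrite !ffunE => e2 e1; move: e2; have := ok p; have := ok' p.
  rewrite /step_ok /target; case: (F p) (F' p) e1 => [t u] [t' u'] /= -> hu hu'.
  move/(congr1 val); rewrite /= !inordK // => /addnI.
  by case: u {hu'}; case: u' {hu}.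
apply: (@le_trans _ _ (\sum_(F in D) G (h F))).
  rewrite big_mkcond [leRHS]big_mkcond; apply: ler_sum => F _.
  rewrite [F \in D]inE; case: (boolP [forall p, step_ok (F p)]) => [/forallP ok|nok]; last first.
    rewrite !andbF; case: ifP => // _.
    have [->//|/move_ok ok] := eqVneq (move_weight F) 0.
    by case/negP: nok; apply/forallP.
  rewrite !andbT; case: ifP => // /and3P[_ _ sz].
  rewrite /G (bigD1_seq (multiplier F)) ?iota_uniq //=; last first.
    by rewrite mem_index_iota multiplier_gt0 ltnS hA.
  rewrite integer_destination // eqxx mul1r move_weight_ok // mulrC lerDl.
  by apply: sumr_ge0 => a _; rewrite !mulr_ge0 ?invsqrt_ge0 ?ler0n ?coefficient_ge0.
rewrite -(big_imset G) //=.
apply: (@le_trans _ _ (\sum_(mm | (mm.1 \in resonator_set) && (mm.2 \in resonator_set)) G mm)).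
  rewrite [leLHS]big_mkcond [leRHS]big_mkcond; apply: ler_sum => mm _.
  case: ifP => [/imsetP[F]|_]; last by case: ifP.
  by rewrite inE => /and4P[h1 h2 _ _] -> /=; rewrite h1 h2.
rewrite -(pair_big (mem resonator_set) (mem resonator_set) (fun m m' => G (m, m'))) /=.
rewrite /G /=; under eq_bigr do rewrite exchange_big /=.
rewrite exchange_big /= le_eqVlt; apply/orP; left; apply/eqP.
apply: eq_bigr => a _; rewrite mulr_sumr; apply: eq_bigr => m _.
rewrite mulr_sumr [RHS]big_mkcondr; apply: eq_bigr => m' _.
by case: eqP; rewrite ?mul1r ?mul0r ?mulr0.
Qed.

End Resonator.

(** * The first moment over a group of characters *)

Section CharacterGroup.
Variables (R : realType) (q : nat).
Implicit Types (chi psi : dirichlet_char R q) (u v : 'Z_q).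

Lemma dchar1 chi : chi 1 = 1.
Proof.
have u1 : chi 1 != 0 by rewrite dchar_neq0 unitr1.
by apply: (mulfI u1); rewrite -dcharM !mulr1.
Qed.

Lemma dcharX chi u n : chi (u ^+ n) = chi u ^+ n.
Proof. by elim: n => [|n IH]; rewrite ?expr0 ?dchar1 // !exprS dcharM IH. Qed.

Lemma dcharV chi u : u \is a GRing.unit -> chi u^-1 = (chi u)^-1.
Proof.
move=> uu; have cu : chi u != 0 by rewrite dchar_neq0.
by apply: (mulfI cu); rewrite -dcharM divrr // dchar1 divff.
Qed.

Lemma dchar_norm chi u : u \is a GRing.unit -> `|chi u| = 1.
Proof.
move=> uu; pose U : {unit 'Z_q} := FinRing.unit _ uu.
have [n n0 un] : exists2 n, (0 < n)%N & u ^+ n = 1.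
  by exists #[U]%g; rewrite ?order_gt0 // -[u]/(val U) -FinRing.val_unitX expg_order.
apply/eqP; rewrite -(@pexpr_eq1 _ _ n) ?normr_ge0 //.
by rewrite -normrX -dcharX un dchar1 normr1.
Qed.

Lemma dchar_conj chi u : u \is a GRing.unit -> Num.conj (chi u) = (chi u)^-1.
Proof. by move=> uu; rewrite invC_norm dchar_norm // expr1n invr1 mul1r. Qed.

Lemma dchar_mulE chi psi u : (chi * psi)%g u = chi u * psi u.
Proof. by rewrite ffunE. Qed.

Lemma dchar_oneE u : u \is a GRing.unit -> (1%g : dirichlet_char R q) u = 1.
Proof. by move=> uu; rewrite ffunE uu. Qed.

Variable G : {fset dirichlet_char R q}.
Hypothesis Ggroup : group_closed [in G].

(** On units, this is congruence modulo the annihilator of [G]. *)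
Definition same_values u v := [forall chi : G, val chi u == val chi v].

Lemma same_valuesP u v :
  reflect (forall chi, chi \in G -> chi u = chi v) (same_values u v).
Proof.
apply: (iffP forallP) => [H chi cG|H chi]; first exact/eqP/(H [` cG]%fset).
by apply/eqP/H/valP.
Qed.

(** Multiplication by a member permutes the group; this gives the
    orthogonality relations and, taking products of values, the fact that the
    order of the group is an exponent ([dchar_expG]). *)
Lemma translation_perm psi : psi \in G -> perm_eq [seq (psi * chi)%g | chi <- G] G.
Proof.
move=> pG; have uniq_l : uniq [seq (psi * chi)%g | chi <- G].
  by rewrite map_inj_uniq ?fset_uniq //; apply: mulgI.
have sub : {subset [seq (psi * chi)%g | chi <- G] <= G}.
  by move=> x /mapP[chi cG ->]; apply: (group_closedM Ggroup).
have sz : (size G <= size [seq (psi * chi)%g | chi <- G])%N by rewrite size_map.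
by have [_ E] := uniq_min_size uniq_l sub sz; apply: uniq_perm; rewrite ?fset_uniq.
Qed.

Lemma dchar_expG chi u : chi \in G -> u \is a GRing.unit -> chi u ^+ #|` G| = 1.
Proof.
move=> cG uu; set P := \prod_(psi <- G) psi u.
have P0 : P != 0 by rewrite prodf_seq_neq0; apply/allP => psi _; rewrite dchar_neq0.
apply: (mulIf P0); rewrite mul1r {2}/P -(perm_big _ (translation_perm cG)) big_map /=.
under [RHS]eq_bigr do rewrite dchar_mulE.
by rewrite big_split /= big_const_seq count_predT -Monoid.iteropE.
Qed.

Lemma sum_dchar u : u \is a GRing.unit ->
  \sum_(chi <- G) chi u = (if same_values u 1 then #|` G|%:R else 0).
Proof.
move=> uu; case: ifPn => [/same_valuesP H|].
  rewrite big_seq (eq_bigr (fun=> 1)) => [|chi cG]; last by rewrite H // dchar1.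
  by rewrite -big_seq big_const_seq count_predT iter_addr_0.
case/forallPn => psi npsi; have pG : val psi \in G := valP psi.
set s := \sum_(chi <- G) chi u.
have : s = val psi u * s.
  rewrite {1}/s -(perm_big _ (translation_perm pG)) big_map mulr_sumr /=.
  by apply: eq_bigr => chi _; rewrite dchar_mulE.
move/eqP; rewrite -subr_eq0 -{1}[s]mul1r -mulrBl mulf_eq0 => /orP[|/eqP//].
by rewrite subr_eq0 eq_sym => /eqP E; move: npsi; rewrite E dchar1 eqxx.
Qed.

Lemma sum_dchar_div u v : u \is a GRing.unit -> v \is a GRing.unit ->
  \sum_(chi <- G) chi u * Num.conj (chi v) = (if same_values u v then #|` G|%:R else 0).
Proof.
move=> uu vu; have uvu : u / v \is a GRing.unit by rewrite unitrM uu unitrV.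
transitivity (\sum_(chi <- G) chi (u / v)).
  by apply: eq_bigr => chi _; rewrite dcharM dcharV // dchar_conj.
rewrite sum_dchar //; congr (if _ then _ else _).
apply/same_valuesP/same_valuesP => H chi cG; have := H chi cG;
  have cv : chi v != 0 by rewrite dchar_neq0.
  by rewrite dcharM dcharV // dchar1 => /eqP; rewrite -subr_eq0 -(divff cv) -mulrBl
    mulf_eq0 invr_eq0 (negbTE cv) orbF subr_eq0 => /eqP.
by rewrite dcharM dcharV // dchar1 => ->; rewrite divff.
Qed.

Definition class_rep u : 'Z_q := odflt u [pick v | same_values u v].

Lemma class_repP u : same_values u (class_rep u).
Proof.
rewrite /class_rep; case: pickP => [//|/(_ u)].
by move/negbT/forallPn => [chi]; rewrite eqxx.
Qed.

Lemma class_rep_eq u v : same_values u v -> class_rep u = class_rep v.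
Proof.
move=> /same_valuesP H; rewrite /class_rep.
have -> : [pick w | same_values u w] = [pick w | same_values v w].
  apply: eq_pick => w; apply/same_valuesP/same_valuesP => K chi cG.
    by rewrite -H // K.
  by rewrite H // K.
case: pickP => [//|/(_ v)]; by move/negbT/forallPn => [chi]; rewrite eqxx.
Qed.

Lemma class_rep_unit u : u \is a GRing.unit -> class_rep u \is a GRing.unit.
Proof.
have [G1 _] := Ggroup.
move=> uu; rewrite -(dchar_neq0 (1%g : dirichlet_char R q)).
by rewrite -(same_valuesP _ _ (class_repP u) _ G1) dchar_neq0.
Qed.

Lemma cauchy_schwarz_sum (I : finType) (D : pred I) (x y : I -> R) :
  (\sum_(i | D i) x i * y i) ^+ 2 <=
  (\sum_(i | D i) x i ^+ 2) * (\sum_(i | D i) y i ^+ 2).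
Proof.
have : 0 <= \sum_(i | D i) \sum_(j | D j) (x i * y j - x j * y i) ^+ 2.
  by do 2!apply: sumr_ge0 => ? _; apply: sqr_ge0.
have E i j : (x i * y j - x j * y i) ^+ 2 =
    x i ^+ 2 * y j ^+ 2 + y i ^+ 2 * x j ^+ 2 - 2 * ((x i * y i) * (x j * y j)) by ring.
under eq_bigr do under eq_bigr do rewrite E.
under eq_bigr do rewrite big_split big_split /= sumrN -!mulr_sumr.
rewrite big_split big_split /= sumrN -!mulr_sumr -!mulr_suml expr2; nra.
Qed.

Variables (I : finType) (M : {set I}) (n : I -> nat) (f : I -> R).
Hypothesis q_prime : prime q.
Hypothesis n_inj : injective n.
Hypothesis n_coprime : forall i, coprime q (n i).
Hypothesis f_ge0 : forall i, 0 <= f i.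

Let residue i : 'Z_q := (n i)%:R.
Let energy := \sum_(i in M) f i ^+ 2.
(** The resonator has one coefficient per class modulo the annihilator,
    namely the square root of the energy that the class receives. Integers that
    [G] cannot separate thus contribute to the second moment as if they were
    orthogonal, and the total is exactly [energy] ([sum_resonator]). *)
Let class_energy v := \sum_(i in M | class_rep (residue i) == v) f i ^+ 2.
Let w v := Num.sqrt (class_energy v).
Let resonator (chi : dirichlet_char R q) : R[i] := \sum_v (w v)%:C * chi v.

Let q_gt1 : (1 < q)%N. Proof. exact: prime_gt1. Qed.

Lemma residue_unit i : residue i \is a GRing.unit.
Proof. by rewrite unitZpE. Qed.

Lemma class_energy_ge0 v : 0 <= class_energy v.
Proof. by apply: sumr_ge0 => i _; apply: sqr_ge0. Qed.

Lemma w_ge0 v : 0 <= w v. Proof. exact: sqrtr_ge0. Qed.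

Lemma w_sqr v : w v ^+ 2 = class_energy v.
Proof. by rewrite sqr_sqrtr ?class_energy_ge0. Qed.

Lemma sum_class_energy : \sum_v class_energy v = energy.
Proof. by rewrite /energy [RHS](partition_big (fun i => class_rep (residue i)) xpredT). Qed.

Lemma w_neq0 v : w v != 0 -> exists2 i, i \in M & v = class_rep (residue i).
Proof.
case: (pickP [pred i | (i \in M) && (class_rep (residue i) == v)]) => [i /andP[iM /eqP <-] _|none].
  by exists i.
by rewrite /w /class_energy big_pred0 ?sqrtr0 ?eqxx.
Qed.

Lemma w_unit v : w v != 0 -> v \is a GRing.unit.
Proof. by case/w_neq0 => i _ ->; apply: class_rep_unit; apply: residue_unit. Qed.

Lemma resonator_norm chi :
  `|resonator chi| ^+ 2 = \sum_v \sum_v' (w v * w v')%:C * (chi v * Num.conj (chi v')).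
Proof.
rewrite normCK /resonator rmorph_sum /= mulr_suml; apply: eq_bigr => v _.
rewrite mulr_sumr; apply: eq_bigr => v' _.
have -> : Num.conj ((w v')%:C * chi v') = (w v')%:C * Num.conj (chi v').
  by rewrite rmorphM /= conj_Creal // realE ler0c w_ge0.
by rewrite rmorphM mulrACA.
Qed.

Lemma sum_twisted_resonator a : a \is a GRing.unit ->
  \sum_(chi <- G) chi a * `|resonator chi| ^+ 2 =
  (#|` G|%:R * \sum_v \sum_(v' | same_values (a * v) v') w v * w v')%:C.
Proof.
move=> ua; under eq_bigr do rewrite resonator_norm mulr_sumr.
rewrite exchange_big /= mulr_sumr rmorph_sum; apply: eq_bigr => v _ /=.
under eq_bigr do rewrite mulr_sumr.
rewrite exchange_big /= mulr_sumr [X in _ = X%:C]big_mkcond /= rmorph_sum; apply: eq_bigr => v' _ /=.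
have [z|nz] := eqVneq (w v * w v') 0.
  rewrite z mulr0 if_same big1 // => chi _; by rewrite mul0r mulr0.
have [vu v'u] : v \is a GRing.unit /\ v' \is a GRing.unit.
  by move: nz; rewrite mulf_eq0 negb_or => /andP[/w_unit ? /w_unit].
transitivity ((w v * w v')%:C * \sum_(chi <- G) chi (a * v) * Num.conj (chi v')).
  by rewrite mulr_sumr; apply: eq_bigr => chi _; rewrite dcharM mulrCA !mulrA.
rewrite sum_dchar_div ?unitrM ?ua //; case: ifP; rewrite ?mulr0 //.
by move=> _; rewrite mulrC -(rmorph_nat (real_complex R)) -rmorphM.
Qed.

Lemma sum_resonator : \sum_(chi <- G) `|resonator chi| ^+ 2 = (#|` G|%:R * energy)%:C.
Proof.
have := sum_twisted_resonator (unitr1 'Z_q).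
under eq_bigr do rewrite dchar1 mul1r.
move=> ->; congr ((_ * _)%:C); rewrite -sum_class_energy; apply: eq_bigr => v _.
rewrite -w_sqr mul1r; have [->|/[dup] vu /w_neq0[i _ vE]] := eqVneq (w v) 0.
  by rewrite big1 ?expr0n // => v' _; rewrite mul0r.
rewrite (bigD1 v) /=; last by apply/same_valuesP.
rewrite -expr2 big1 ?addr0 // => v' /andP[vv' v'v].
have [->|/w_neq0[i' _ v'E]] := eqVneq (w v') 0; first by rewrite mulr0.
case/eqP: v'v; have vv := class_rep_eq vv'.
have idem u : class_rep (class_rep u) = class_rep u.
  by apply/esym/class_rep_eq/class_repP.
by rewrite v'E vE !idem -v'E -vE in vv; rewrite vv.
Qed.

(** Multiplication by [a] maps the class of [n i] to the class of
    [a * n i = n j]. By Cauchy-Schwarz the pairs between two given classes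
    contribute at most the product of their square-root energies: both [i] and
    [j] occur in at most one pair, because [n] is injective. *)
Lemma matched_pairs_le a : coprime q a ->
  \sum_(i in M) \sum_(j in M | n j == (a * n i)%N) f i * f j <=
  \sum_v \sum_(v' | same_values (a%:R * v) v') w v * w v'.
Proof.
move=> ca; apply: (@le_trans _ _ (\sum_v w v * w (class_rep (a%:R * v)))); last first.
  apply: ler_sum => v _; rewrite (bigD1 (class_rep (a%:R * v))) ?class_repP //= lerDl.
  by apply: sumr_ge0 => v' _; rewrite mulr_ge0 ?w_ge0.
rewrite (partition_big (fun i => class_rep (residue i)) xpredT) //=.
apply: ler_sum => v _.
rewrite pair_big_dep /=.
pose D (p : I * I) := [&& (p.1 \in M) && (class_rep (residue p.1) == v), p.2 \in M &
  n p.2 == (a * n p.1)%N].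
rewrite -[leLHS]/(\sum_(p | D p) f p.1 * f p.2).
rewrite -[leLHS]ger0_norm; last first.
  by apply: sumr_ge0 => -[i j] _; rewrite mulr_ge0 ?f_ge0.
rewrite -sqrtr_sqr /w -sqrtrM ?class_energy_ge0 // ler_wsqrtr //.
apply: le_trans (cauchy_schwarz_sum _ (fun p : I * I => f p.1) (fun p => f p.2)) _.
have key (h : I * I -> I) (C : pred I) :
    (forall p p', D p -> D p' -> h p = h p' -> p = p') -> (forall p, D p -> C (h p)) ->
    \sum_(p | D p) f (h p) ^+ 2 <= \sum_(i | C i) f i ^+ 2.
  move=> hinj hC.
  have -> : \sum_(p | D p) f (h p) ^+ 2 = \sum_(p in finset D) f (h p) ^+ 2.
    by apply: eq_bigl => p; rewrite inE.
  rewrite -(big_imset (fun i => f i ^+ 2)) /=; last first.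
    by move=> p p'; rewrite !inE => Dp Dp'; apply: hinj.
  rewrite big_mkcond [leRHS]big_mkcond; apply: ler_sum => i _.
  case: ifP => [/imsetP[p]|_]; last by case: ifP => // _; apply: sqr_ge0.
  by rewrite inE => Dp ->; rewrite hC.
have Dspec p : D p -> [/\ p.1 \in M, class_rep (residue p.1) = v, p.2 \in M &
    n p.2 = (a * n p.1)%N].
  by case/andP => /andP[h1 /eqP h2] /andP[h3 /eqP h4].
have a0 : (0 < a)%N by case: (a) ca => //; rewrite /coprime gcdn0 => /eqP q1; move: q_gt1; rewrite q1.
apply: ler_pM; [by apply: sumr_ge0 => p _; apply: sqr_ge0|by apply: sumr_ge0 => p _; apply: sqr_ge0| |].
- apply: key => [[i j] [i' j'] /Dspec[/= _ _ _ e] /Dspec[/= _ _ _ e'] ii'|].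
    2: by move=> p /Dspec[-> -> _ _]; rewrite eqxx.
  by rewrite -ii' -e in e'; rewrite ii' (n_inj e').
- apply: key => [[i j] [i' j'] /Dspec[/= _ _ _ e] /Dspec[/= _ _ _ e'] jj'|p /Dspec[_ cv -> e]/=].
    move: e'; rewrite -jj' e => /eqP; rewrite eqn_pmul2l // => /eqP /n_inj ->.
    by rewrite jj'.
  apply/eqP/esym/class_rep_eq/same_valuesP => chi cG.
  rewrite /residue e natrM !dcharM; congr (_ * _).
  by rewrite -cv; apply/esym/(same_valuesP _ _ (class_repP _)).
Qed.

(** Cauchy-Schwarz over the classes that occur, of which there are at most
    [#|M|]. *)
Lemma resonator1_le : (\sum_v w v) ^+ 2 <= #|M|%:R * energy.
Proof.
have -> : \sum_v w v = \sum_(v | w v != 0) 1 * w v.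
  rewrite [RHS]big_mkcond; apply: eq_bigr => v _; rewrite mul1r.
  by case: eqVneq.
apply: le_trans (cauchy_schwarz_sum _ _ _) _.
apply: ler_pM; [by apply: sumr_ge0 => ? _; apply: sqr_ge0|by apply: sumr_ge0 => ? _; apply: sqr_ge0| |].
  under eq_bigr do rewrite expr1n.
  rewrite sumr_const ler_nat.
  apply: leq_trans (leq_imset_card (fun i => class_rep (residue i)) M).
  apply: subset_leq_card; apply/fintype.subsetP => v /w_neq0[i iM ->].
  exact: imset_f.
rewrite -sum_class_energy big_mkcond; apply: ler_sum => v _.
by case: ifP => _; rewrite ?w_sqr // class_energy_ge0.
Qed.

(** The moment of the sums [\sum_a g a * chi a] is computed in two ways: from
    below by its matched pairs, all terms being nonnegative, and from above by
    the triangle inequality, where the principal character is bounded on its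
    own. *)
Theorem resonance (g : nat -> R) (V : R) :
  (forall a, (0 < a < q)%N -> 0 <= g a) -> 0 <= V ->
  (forall chi, chi \in G -> chi != 1%g ->
     `|\sum_(1 <= a < q) (g a)%:C * chi a%:R| <= V%:C) ->
  #|` G|%:R * \sum_(1 <= a < q) g a *
     (\sum_(i in M) \sum_(j in M | n j == (a * n i)%N) f i * f j) <=
  (#|` G|%:R * V + (\sum_(1 <= a < q) g a) * #|M|%:R) * energy.
Proof.
move=> g0 V0 bound.
pose S (chi : dirichlet_char R q) : R[i] := \sum_(1 <= a < q) (g a)%:C * chi a%:R.
have aU a : (0 < a < q)%N -> coprime q a.
  by move=> /andP[a0 aq]; rewrite prime_coprime // gtnNdvd.
have G1 : 1%g \in G by case: Ggroup.
have sumS : \sum_(chi <- G) S chi * `|resonator chi| ^+ 2 =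
    (#|` G|%:R * \sum_(1 <= a < q) g a *
       (\sum_v \sum_(v' | same_values (a%:R * v) v') w v * w v'))%:C.
  under eq_bigr do rewrite mulr_suml.
  rewrite exchange_big /= mulr_sumr rmorph_sum /= !big_nat; apply: eq_bigr => a aq.
  rewrite mulrCA rmorphM /= -sum_twisted_resonator ?unitZpE ?aU // mulr_sumr.
  by apply: eq_bigr => chi _; rewrite -mulrA.
have R0 (x : R[i]) : 0 <= `|x| ^+ 2 by rewrite exprn_ge0.
rewrite -lecR; apply: (@le_trans _ _ (\sum_(chi <- G) S chi * `|resonator chi| ^+ 2)).
  rewrite sumS lecR ler_wpM2l ?ler0n // !big_nat; apply: ler_sum => a aq.
  by rewrite ler_wpM2l ?g0 // matched_pairs_le // aU.
have sumS0 : 0 <= \sum_(chi <- G) S chi * `|resonator chi| ^+ 2.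
  rewrite sumS ler0c mulr_ge0 ?ler0n // big_nat; apply: sumr_ge0 => a aq.
  rewrite mulr_ge0 ?g0 //; do 2!apply: sumr_ge0 => ? _.
  by rewrite mulr_ge0 ?w_ge0.
rewrite -(ger0_norm sumS0); apply: le_trans (ler_norm_sum _ _ _) _.
pose P1 := ((\sum_(1 <= a < q) g a) * #|M|%:R * energy)%:C.
have principal : `|S 1%g| * `|resonator 1%g| ^+ 2 <= P1.
  have -> : S 1%g = (\sum_(1 <= a < q) g a)%:C.
    rewrite rmorph_sum /S /= !big_nat; apply: eq_bigr => a aq.
    by rewrite dchar_oneE ?mulr1 // unitZpE ?aU.
  have -> : resonator 1%g = (\sum_v w v)%:C.
    rewrite rmorph_sum /resonator /=; apply: eq_bigr => v _.
    have [->|/w_unit vu] := eqVneq (w v) 0; first by rewrite mul0r.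
    by rewrite dchar_oneE ?mulr1.
  have g1 : 0 <= \sum_(1 <= a < q) g a by rewrite big_nat; apply: sumr_ge0.
  have w1 : 0 <= \sum_v w v by apply: sumr_ge0 => v _; apply: w_ge0.
  rewrite !ger0_norm ?ler0c //.
  by rewrite -rmorphXn -rmorphM lecR -mulrA ler_wpM2l // resonator1_le.
apply: (@le_trans _ _ (\sum_(chi <- G) (V%:C * `|resonator chi| ^+ 2 +
   (if chi == 1%g then P1 else 0)))).
  rewrite big_seq [leRHS]big_seq; apply: ler_sum => chi cG.
  rewrite normrM normrX normr_id; case: eqVneq => [->|c1].
    by rewrite (le_trans principal) // lerDr mulr_ge0 ?ler0c.
  by rewrite addr0 ler_wpM2r ?bound.
rewrite big_split /= -mulr_sumr sum_resonator.
rewrite [X in _ + X](bigD1_seq 1%g) ?fset_uniq //= eqxx.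
rewrite [X in _ + (_ + X)]big1 ?addr0 => [|chi /negbTE -> //].
by rewrite /P1 -rmorphM -rmorphD lecR le_eqVlt; apply/orP; left; apply/eqP; ring.
Qed.

End CharacterGroup.

(** * Evenness *)

(** Some nonzero [x] has [x ^ ((q - 1) / 2) <> 1], since a polynomial of that
    degree has too few roots; the value is a square root of 1, hence [- 1]. *)
Lemma minus1_is_power q : prime q -> odd q -> exists x : 'F_q, x ^+ q.-1./2 = -1.
Proof.
move=> pq oq; have q1 := prime_gt1 pq; set m := q.-1./2.
have m0 : (0 < m)%N by rewrite /m; have := odd_prime_gt2 oq pq; lia.
have mE : (m + m = q.-1)%N by rewrite /m; lia.
have [x x0 xm] : exists2 x : 'F_q, x != 0 & x ^+ m != 1.
  case: (pickP [pred x : 'F_q | (x != 0) && (x ^+ m != 1)]) => [x /andP[]|H]; first by exists x.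
  have := @max_unity_roots 'F_q m [seq x <- enum 'F_q | x != 0] m0.
  rewrite filter_uniq ?enum_uniq // => /(_ _ isT).
  have -> : all m.-unity_root [seq x <- enum 'F_q | x != 0].
    apply/allP => x; rewrite mem_filter => /andP[x0 _]; apply/unity_rootP/eqP.
    by have := H x; rewrite /= x0 /= => /negbFE.
  move=> /(_ isT); rewrite size_filter.
  have := count_predC (pred1 0) (enum 'F_q); rewrite -cardE card_Fp //.
  have -> : count (pred1 0) (enum 'F_q) = 1%N by rewrite count_uniq_mem ?enum_uniq ?mem_enum.
  rewrite (eq_count (_ : predC (pred1 0) =1 (fun x => x != 0))) //; lia.
exists x; have := expf_card x; rewrite card_Fp //.
have -> : x ^+ q = x ^+ q.-1.+1 by rewrite prednK // ltnW.
rewrite exprS => /eqP.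
rewrite -[eqbRHS]mulr1 (inj_eq (mulfI x0)) -mE exprD -expr2 sqrf_eq1 (negbTE xm) /=.
by move/eqP.
Qed.

(** [- 1] is a power [y ^ ((q - 1) / 2)] and the order [H / 2] of the group
    divides [(q - 1) / 2], so every [chi] of the group sends [- 1] to 1. *)
Lemma subgroup_even (R : realType) (q H : nat) (G : {fset dirichlet_char R q}) :
  prime q -> (H %| q.-1)%N -> ~~ odd H -> group_closed [in G] -> #|` G| = H./2 ->
  {in G, forall chi, even_dchar chi}.
Proof.
move=> pq /dvdnP[k kH] evH gG cG chi chiG.
have oq : odd q.
  have /even_prime[q2|//] := pq; move: kH; rewrite q2 /= => kH.
  by move: (congr1 odd kH); rewrite oddM (negbTE evH) andbF.
have [x xE] := minus1_is_power pq oq.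
have [y yE] : exists y : 'Z_q, y ^+ q.-1./2 = -1.
  by move: x xE; rewrite /= (pdiv_id pq) => x xE; exists x.
rewrite /even_dchar -yE; have mE : (q.-1./2 = k * H./2)%N.
  by rewrite kH -{1}(even_halfK evH) -doubleMr doubleK.
have m0 : (0 < q.-1./2)%N by have := odd_prime_gt2 oq pq; lia.
have yu : y \is a GRing.unit by rewrite -(unitrX_pos _ m0) yE unitrN1.
by rewrite mE exprM dcharX -cG dchar_expG // unitrX.
Qed.

(** * L(1/2, chi) as a finite sum *)

Section LFunction.
Variables (R : realType) (q : nat).
Hypothesis q_prime : prime q.
Let q_gt1 : (1 < q)%N. Proof. exact: prime_gt1. Qed.
Let q_gt0 : (0 < q)%N. Proof. exact: ltnW. Qed.
Let rs (n : nat) : R := invsqrt R n.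

Lemma invsqrt_le m n : (0 < m)%N -> (m <= n)%N -> invsqrt R n <= invsqrt R m.
Proof.
move=> m0 mn; rewrite /invsqrt lef_pV2 ?posrE ?sqrtr_gt0 ?ltr0n ?(leq_trans m0) //.
by rewrite ler_wsqrtr // ler_nat.
Qed.

(** The coefficient of [chi a] in L(1/2, chi), after summation over the
    residue class of [a]. The subtracted term does not depend on [a], so it
    cancels against a full period of [chi], and it makes the sum converge. As
    it never exceeds the term before it, the kernel is nonnegative. *)
Definition partial_kernel (a K : nat) : R :=
  \sum_(k < K) (rs (a + k * q) - rs (q + k * q)).
Definition kernel (a : nat) : R := limn (partial_kernel a).

Lemma partial_kernel_nondecreasing a : (0 < a <= q)%N ->
  nondecreasing_seq (partial_kernel a).
Proof.
move=> /andP[a0 aq]; apply/nondecreasing_seqP => K.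
rewrite /partial_kernel big_ord_recr /= lerDl subr_ge0 invsqrt_le ?leq_add2r //.
by rewrite addn_gt0 a0.
Qed.

Lemma partial_kernel_le a K K' : (0 < a <= q)%N -> (K <= K')%N ->
  partial_kernel a K' <= partial_kernel a K + rs (a + K * q) - rs (a + K' * q).
Proof.
move=> /andP[a0 aq]; elim: K' => [|K' IH]; first by rewrite leqn0 => /eqP ->; lra.
rewrite leq_eqVlt => /orP[/eqP <-|]; first lra.
rewrite ltnS => /IH; rewrite /partial_kernel big_ord_recr /= => {}IH.
have : rs (a + K'.+1 * q) <= rs (q + K' * q).
  by apply: invsqrt_le; rewrite ?addn_gt0 ?q_gt0 // mulSn; lia.
lra.
Qed.

Lemma partial_kernel_cvg a : (0 < a <= q)%N -> partial_kernel a K @[K --> \oo] --> kernel a.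
Proof.
move=> aq; apply: nondecreasing_is_cvgn; first exact: partial_kernel_nondecreasing.
exists (rs a) => _ [K _ <-].
have := partial_kernel_le aq (leq0n K); rewrite {2}/partial_kernel big_ord0 mul0n addn0.
have := invsqrt_ge0 R (a + K * q); rewrite -/(rs _); lra.
Qed.

Lemma partial_kernel_le_kernel a K : (0 < a <= q)%N -> partial_kernel a K <= kernel a.
Proof.
move=> aq; apply: nondecreasing_cvgn_le; first exact: partial_kernel_nondecreasing.
by apply/cvg_ex; exists (kernel a); apply: partial_kernel_cvg.
Qed.

(** The remainder is an alternating sum with decreasing terms. *)
Lemma kernel_le_partial_kernel a K : (0 < a <= q)%N ->
  kernel a <= partial_kernel a K + rs (a + K * q).
Proof.
move=> aq; apply: limr_le.
  by apply/cvg_ex; exists (kernel a); apply: partial_kernel_cvg.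
exists K => // K' /= KK'; have := partial_kernel_le aq KK'.
have := invsqrt_ge0 R (a + K' * q); rewrite -/(rs _); lra.
Qed.

Lemma kernel_ge a : (0 < a <= q)%N -> rs a - rs q <= kernel a.
Proof.
move=> aq; have := partial_kernel_le_kernel 1 aq.
by rewrite /partial_kernel big_ord1 mul0n !addn0.
Qed.

Lemma kernel_le a : (0 < a <= q)%N -> kernel a <= rs a.
Proof.
move=> aq; have := kernel_le_partial_kernel 0 aq.
by rewrite /partial_kernel big_ord0 mul0n addn0 add0r.
Qed.

Variable chi : dirichlet_char R q.
Hypothesis chi1 : chi != 1%g.

Lemma dchar0 : chi 0 = 0.
Proof. by apply/eqP; rewrite -[_ == _]negbK dchar_neq0 unitr0. Qed.

Lemma sum_dchar_residues : \sum_(0 <= a < q) chi a%:R = 0.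
Proof.
have [u uu cu] : exists2 u : 'Z_q, u \is a GRing.unit & chi u != 1.
  apply/exists_inP; apply: contraNT chi1 => /exists_inPn H.
  apply/eqP/val_inj/ffunP => u; rewrite ffunE; case: (boolP (u \is a GRing.unit)) => uu.
    by apply/eqP/negPn/H.
  by apply/eqP; rewrite -[_ == _]negbK dchar_neq0.
have -> : \sum_(0 <= a < q) chi a%:R = \sum_(x : 'Z_q) chi x.
  rewrite -{1}(Zp_cast q_gt1) big_mkord; apply: eq_bigr => x _.
  by rewrite natr_Zp.
apply/eqP; move: cu; apply: contraNT => s0; apply/eqP.
apply: (mulIf s0); rewrite mul1r mulr_sumr [RHS](reindex_inj (mulrI uu)) /=.
by apply: eq_bigr => x _; rewrite dcharM.
Qed.

Lemma dchar_periodic a k : chi (a + k * q)%:R = chi a%:R.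
Proof. by congr (chi _); apply/val_inj; rewrite /= !val_Zp_nat // addnC modnMDl. Qed.

Lemma sum_full_periods K : \sum_(0 <= n < K * q) chi n%:R * (rs n)%:C =
  \sum_(1 <= a < q) (partial_kernel a K)%:C * chi a%:R.
Proof.
elim: K => [|K IH].
  rewrite big_geq // big1 // => a _; by rewrite /partial_kernel big_ord0 mul0r.
rewrite (@big_cat_nat _ _ _ (K * q)) ?leq_mul //= IH.
have -> : \sum_(K * q <= n < K.+1 * q) chi n%:R * (rs n)%:C =
    \sum_(0 <= a < q) chi a%:R * (rs (a + K * q) - rs (q + K * q))%:C.
  rewrite mulSn -{1}[(K * q)%N]add0n big_addn addnK.
  under [RHS]eq_bigr do rewrite rmorphB mulrBr.
  rewrite sumrB -mulr_suml sum_dchar_residues mul0r subr0.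
  by apply: eq_bigr => a _; rewrite dchar_periodic.
rewrite [X in _ + X]big_ltn // mulr0n dchar0 mul0r add0r -big_split /=.
apply: eq_bigr => a _; rewrite /partial_kernel big_ord_recr /= [in RHS]rmorphD [RHS]mulrDl.
by congr (_ + _); rewrite mulrC.
Qed.

Lemma natCpow_half n : (0 < n)%N -> natCpow n (- (2^-1 : R[i])) = (rs n)%:C.
Proof.
move=> n0; have E : - (2^-1 : R[i]) = (- 2^-1)%:C.
  by rewrite rmorphN rmorphV ?unitfE // rmorph_nat.
rewrite /natCpow E /= mul0r cos0 sin0 -[1 +i* 0]/(1 : R[i]) mulr1.
by rewrite /rs /invsqrt powRN powR12_sqrt.
Qed.

(** The partial sum up to [N] is split at the last multiple of [q]. The full
    periods give [partial_kernel], whose distance from [kernel] is at most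
    [rs K]; the incomplete period has at most [q] terms of size [rs K]. *)
Lemma dirichlet_L_half :
  dirichlet_L 2^-1 chi = \sum_(1 <= a < q) (kernel a)%:C * chi a%:R.
Proof.
set L := (X in _ = X); rewrite /dirichlet_L.
have norm_le1 n : `|chi n%:R| <= 1.
  have [nu|nnu] := boolP ((n%:R : 'Z_q) \is a GRing.unit); first by rewrite dchar_norm.
  by move: nnu; rewrite -(dchar_neq0 chi) negbK => /eqP ->; rewrite normr0 ler01.
have norm_term x n (d : R) : 0 <= x <= d -> `|x%:C * chi n%:R| <= d%:C.
  move=> /andP[x0 xd]; rewrite normrM ger0_norm ?ler0c //.
  by apply: le_trans (_ : x%:C <= _); rewrite ?lecR // ler_piMr ?ler0c.
pose S N := \sum_(1 <= n < N.+1) chi n%:R * natCpow n (- (2^-1 : R[i])).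
have bound K N : (0 < K)%N -> (K * q <= N.+1)%N -> (N.+1 <= K * q + q)%N ->
  `|L - S N| <= (2 * q%:R * rs K)%:C.
  move=> K0 KN NK.
  have -> : S N = \sum_(0 <= n < N.+1) chi n%:R * (rs n)%:C.
    rewrite [RHS]big_ltn // dchar0 mul0r add0r /S !big_nat; apply: eq_bigr => n /andP[n0 _].
    by rewrite natCpow_half.
  rewrite (@big_cat_nat _ _ _ (K * q)) //= sum_full_periods opprD addrA.
  have -> : 2 * q%:R * rs K = q%:R * rs K + q%:R * rs K by ring.
  rewrite rmorphD; apply: le_trans (ler_normB _ _) _; apply: lerD.
    rewrite /L -sumrB; under eq_bigr do rewrite -mulrBl -rmorphB.
    apply: le_trans (ler_norm_sum _ _ _) _.
    apply: (@le_trans _ _ (\sum_(1 <= a < q) (rs K)%:C)).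
      rewrite !big_nat; apply: ler_sum => a /andP[a0 aq]; apply: norm_term.
      have aq' : (0 < a <= q)%N by rewrite a0 ltnW.
      have h1 := partial_kernel_le_kernel K aq'; have h2 := kernel_le_partial_kernel K aq'.
      have h3 : rs (a + K * q) <= rs K.
        by apply: invsqrt_le => //; rewrite (leq_trans _ (leq_addl _ _)) // leq_pmulr.
      by apply/andP; split; lra.
    rewrite sumr_const_nat -(rmorphMn (real_complex R)) /= lecR -mulr_natl.
    by rewrite ler_wpM2r ?invsqrt_ge0 // ler_nat leq_subr.
  apply: le_trans (ler_norm_sum _ _ _) _.
  apply: (@le_trans _ _ (\sum_(K * q <= n < N.+1) (rs K)%:C)).
    rewrite !big_nat; apply: ler_sum => n /andP[nK _]; rewrite mulrC; apply: norm_term.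
    by rewrite invsqrt_ge0 invsqrt_le // (leq_trans _ nK) // leq_pmulr.
  rewrite sumr_const_nat -(rmorphMn (real_complex R)) /= lecR -mulr_natl.
  by rewrite ler_wpM2r ?invsqrt_ge0 // ler_nat leq_subLR.
suff cvgS : (S N : R[i]^o) @[N --> \oo] --> (L : R[i]^o).
  by apply: (cvg_lim _ cvgS); apply: norm_hausdorff.
apply/cvgrPdist_le => /= e e0.
have eE : e = (complex.Re e)%:C by rewrite RRe_real // gtr0_real.
have r0 : 0 < complex.Re e by rewrite -ltcR -eE.
pose d := complex.Re e; pose K0 := (Num.truncn ((2 * q%:R / d) ^+ 2)).+1.
exists (K0 * q)%N => // N /= KN.
pose K := (N.+1 %/ q)%N.
have K0K : (K0 <= K)%N by rewrite leq_divRL // (leq_trans KN).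
apply: le_trans (bound K N _ _ _) _.
- by apply: leq_trans K0K.
- by rewrite leq_divM.
- by rewrite ltnW // addnC -mulSn ltn_ceil.
rewrite eE lecR -/d; have q0 : 0 < q%:R :> R by rewrite ltr0n.
have Kp : 0 < Num.sqrt K%:R :> R by rewrite sqrtr_gt0 ltr0n (leq_trans _ K0K).
rewrite /rs /invsqrt ler_pdivrMr // -ler_pdivrMl // [d^-1 * _]mulrC.
rewrite -[leLHS]ger0_norm; last by rewrite divr_ge0 ?mulr_ge0 // ltW.
rewrite -sqrtr_sqr ler_wsqrtr // ltW //.
by apply: lt_le_trans (truncnS_gt _) _; rewrite ler_nat.
Qed.

End LFunction.

(** * Blocks of primes *)

(** The tail exponent for the tilt [tau = eta / 2], mass [n], gain [g] and
    threshold [(1 + eta) n]. The main part is of order [- eta ^ 2 * n], and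
    [eta ^ 2 * n] is a large multiple of [s]. *)
Lemma tilted_exponent_le (R : realType) (eta n g s : R) :
  0 < eta -> eta <= 1 / 4 -> 0 <= g -> g <= n * eta / 8 -> 0 < n -> 0 <= s ->
  128 * s <= n * eta ^+ 2 ->
  (expR (eta / 2) - 1) * (n + g / 2) - eta / 2 * ((1 + eta) * n) <= - (16 * s).
Proof.
move=> e0 e1 g0 g1 n0 s0 key.
(* The inequality exp t - 1 <= t + 8/7 t^2, valid for t <= 1/8. *)
have ex : expR (eta / 2) - 1 <= eta / 2 + 8 / 7 * (eta / 2) ^+ 2.
  (* Invert the bound of [exp (- t)]. *)
  have h : 1 - eta / 2 <= expR (- (eta / 2)) by exact: expR_ge1Dx.
  have E0 := expR_gt0 (eta / 2); rewrite expRN in h.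
  move: (expR (eta / 2)) h E0 => E h E0.
  have {}h : (1 - eta / 2) * E <= 1 by rewrite -(ler_pdivlMr _ _ E0) div1r.
  have h2 : 1 <= (1 - eta / 2) * (1 + eta / 2 + 8 / 7 * (eta / 2) ^+ 2).
    have : 0 <= eta ^+ 2 * (1 / 4 - eta) by rewrite mulr_ge0 ?sqr_ge0 // subr_ge0.
    by rewrite !expr2; nra.
  have e2 : 0 < 1 - eta / 2 by lra.
  by have := le_trans h h2; rewrite ler_pM2l //; lra.
have ex0 : 0 <= expR (eta / 2) - 1 by rewrite subr_ge0 -expR0 ler_expR divr_ge0 // ltW.
move: (expR (eta / 2) - 1) ex ex0 => E ex ex0.
have ex2 : E <= eta by apply: le_trans ex _; rewrite expr2; nra.
have h1 : E * n <= (eta / 2 + 8 / 7 * (eta / 2) ^+ 2) * n by rewrite ler_wpM2r // ltW.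
have h2 : E * (g / 2) <= eta * (n * eta / 16).
  by apply: ler_pM; rewrite ?divr_ge0 //; lra.
rewrite mulrDr; apply: le_trans (_ : (eta / 2 + 8 / 7 * (eta / 2) ^+ 2) * n + eta * (n * eta / 16) -
    eta / 2 * ((1 + eta) * n) <= _).
  by rewrite lerD2r lerD.
have -> : (eta / 2 + 8 / 7 * (eta / 2) ^+ 2) * n + eta * (n * eta / 16) - eta / 2 * ((1 + eta) * n)
  = - (17 / 112 * (n * eta ^+ 2)) by field.
by rewrite lerN2; move: key; move: (n * eta ^+ 2) => z; lra.
Qed.

Lemma add_blocks k T : (2 <= k)%N -> (T + (k - 2) * T + T = k * T)%N.
Proof. by move=> /subnKC {2}<-; rewrite mulnDl mul2n -addnn addnAC addnC addnA. Qed.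

(** Here [L] is the admissible logarithm of the size of the support and
    [l = ln L], while [k = 1 / eta] is a fixed large integer. The heights
    [kappa j] run geometrically, with ratio [1 + eta], through about
    [l ^ (1 / k), l ^ (1 - 1 / k)], because [(1 + eta) ^ (k * T)] is about [l];
    there are [B = (k - 2) * T] of them, and [B * eta] is about [ln l]. Block
    [j] consists of the primes between [X * exp (kappa j)] and
    [X * exp (kappa j.+1)]. Omitting small heights lets Mertens' theorem apply
    to each block and makes the [r p] small, while the omission of large heights
    keeps the primes below [exp ((1 + eta) * l)]. With [k] fixed and [T] as in
    [block_parameter_spec], the hypotheses all hold for large [l]. *)
Section Blocks.
Variables (R : realType) (k T : nat) (l : R).
Let kR : R := k%:R.
Let eta : R := kR^-1.
Let L : R := expR l.
Let X : R := L / l.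
Let B := ((k - 2) * T)%N.
Let kappa (j : nat) : R := (1 + eta) ^+ (T + j).
Hypothesis k_ge4 : (4 <= k)%N.
Hypothesis kappa_le : (1 + eta) ^+ (k * T) <= l.
Hypothesis T_ge : (1 - eta) * ln l <= T%:R.
Hypothesis ln_l_ge1 : 1 <= ln l.
Hypothesis base_large : 6 * kR ^+ 2 <= (1 + eta) ^+ T.
Hypothesis T_small : 2 * kR ^+ 2 * T%:R <= l.
Hypothesis exp_base_large : 4 * kR * (l ^+ 2 + 1) <= expR ((1 + eta) ^+ T).
Hypothesis sqrt_large : 256 * kR ^+ 2 * l ^+ 2 <= expR (l / 2).
Hypothesis L_large : 8 * l ^+ 2 * expR (3 / 4 * l) + 12 * l <= expR l.

Let k0 : 4 <= kR. Proof. by rewrite ler_nat. Qed.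
Let eta_gt0 : 0 < eta. Proof. by rewrite invr_gt0 (lt_le_trans _ k0). Qed.
Let eta_le : eta <= 1 / 4.
Proof. by rewrite div1r lef_pV2 ?posrE ?(lt_le_trans _ k0). Qed.
Let eta_k : eta * kR = 1. Proof. by rewrite mulVf // gt_eqF ?(lt_le_trans _ k0). Qed.
Ltac eta_facts := have := k0; have := eta_gt0; have := eta_le.
Let omega_ge1 : 1 <= 1 + eta. Proof. eta_facts; lra. Qed.
Let T_gt0 : (0 < T)%N.
Proof.
rewrite -(ltr_nat R); apply: lt_le_trans T_ge; rewrite mulr_gt0 ?(lt_le_trans _ ln_l_ge1) //.
by eta_facts; lra.
Qed.
Let l_ge1 : 1 <= l. Proof. by apply: le_trans kappa_le; rewrite exprn_ege1. Qed.
Let l_gt0 : 0 < l. Proof. exact: lt_le_trans l_ge1. Qed.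
Let B_gt0 : (0 < B)%N. Proof. by rewrite /B muln_gt0 T_gt0 andbT subn_gt0 (leq_trans _ k_ge4). Qed.
Let B_eta : B%:R * eta = (1 - 2 * eta) * T%:R.
Proof.
rewrite /B natrM natrB; last exact: leq_trans k_ge4.
by rewrite -/kR mulrAC mulrBl [kR * eta]mulrC eta_k; ring.
Qed.
Let B_le : B%:R <= eta * l / 2.
Proof.
have : B%:R <= kR * T%:R by rewrite -natrM ler_nat leq_mul2r leq_subr orbT.
have H : eta * (2 * kR ^+ 2 * T%:R) <= eta * l by rewrite ler_wpM2l // ltW.
have : eta * (2 * kR ^+ 2 * T%:R) = 2 * (kR * T%:R).
  have -> : eta * (2 * kR ^+ 2 * T%:R) = (eta * kR) * (2 * (kR * T%:R)) by ring.
  by rewrite eta_k mul1r.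
lra.
Qed.
Let L_gt0 : 0 < L. Proof. exact: expR_gt0. Qed.
Let l_le_L : l <= L. Proof. by rewrite /L; have := @expR_ge1Dx R l; lra. Qed.
Let X_ge1 : 1 <= X. Proof. by rewrite ler_pdivlMr ?mul1r. Qed.
Let X_gt0 : 0 < X. Proof. exact: lt_le_trans X_ge1. Qed.
Let X_le_L : X <= L.
Proof. by rewrite ler_pdivrMr // ler_peMr // ltW. Qed.

Let kappa_ge j : (1 + eta) ^+ T <= kappa j.
Proof. by rewrite /kappa exprD ler_peMr ?exprn_ge0 ?exprn_ege1 // (le_trans _ omega_ge1). Qed.
Let base_ge : 96 <= (1 + eta) ^+ T.
Proof. by apply: le_trans base_large; rewrite expr2; have := k0; nra. Qed.
Let kappa_ge96 j : 96 <= kappa j. Proof. exact: le_trans base_ge (kappa_ge j). Qed.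
Let kappa_gt0 j : 0 < kappa j. Proof. exact: lt_le_trans (kappa_ge96 j). Qed.
Let kappaS j : kappa j.+1 = (1 + eta) * kappa j.
Proof. by rewrite /kappa addnS exprS. Qed.
Let kappa_mono i j : (i <= j)%N -> kappa i <= kappa j.
Proof. by move=> ij; rewrite /kappa ler_weXn2l ?leq_add2l. Qed.
Let kappa_top j : (j < B)%N -> kappa j.+1 <= eta * l.
Proof.
move=> jB; apply: le_trans (kappa_mono jB) _.
have : kappa B * (1 + eta) ^+ T <= l.
  apply: le_trans kappa_le; rewrite /kappa -exprD ler_weXn2l //.
  by rewrite /B add_blocks // (leq_trans _ k_ge4).
have h : kR <= (1 + eta) ^+ T by apply: le_trans base_large; rewrite expr2; have := k0; nra.
have h' : kappa B * kR <= kappa B * (1 + eta) ^+ T by rewrite ler_wpM2l // ltW.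
move=> h2; have -> : kappa B = eta * (kappa B * kR) by rewrite mulrCA eta_k mulr1.
by rewrite ler_wpM2l ?(ltW eta_gt0) // (le_trans h').
Qed.

Let N := (Num.truncn (expR (2 * l))).+1.
(* The bound [N] only makes the index type finite. *)
Let block_primes : {set 'I_B * 'I_N} :=
  finset (fun z : 'I_B * 'I_N =>
    prime z.2 && (X * expR (kappa z.1) < z.2%:R <= X * expR (kappa z.1.+1))).
Let P := {z | z \in block_primes}.
Let pr (x : P) : nat := (val x).2.
Let b (x : P) : 'I_B := (val x).1.

Let P_spec (x : P) : [/\ prime (pr x), X * expR (kappa (b x)) < (pr x)%:R &
  (pr x)%:R <= X * expR (kappa (b x).+1)].
Proof. by have := valP x; rewrite inE => /andP[? /andP[? ?]]; split. Qed.

Let pr_prime x : prime (pr x). Proof. by case: (P_spec x). Qed.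

Let pr_inj : injective pr.
Proof.
move=> x x' E; have [_ h1 h2] := P_spec x; have [_ h3 h4] := P_spec x'.
have key (i j : 'I_B) : X * expR (kappa i) < X * expR (kappa j.+1) -> (i <= j)%N.
  rewrite ltr_pM2l // ltr_expR leqNgt => h; apply/negP => ji.
  by have := kappa_mono ji; rewrite leNgt h.
have bE : b x = b x'.
  rewrite -E in h3 h4; apply/val_inj/eqP.
  by rewrite eqn_leq !key // ?(lt_le_trans h1 h4) ?(lt_le_trans h3 h2).
by apply: val_inj; move: bE E; rewrite /b /pr; case: (val x) (val x') => [? ?] [? ?] /= -> /val_inj ->.
Qed.

Let pr_gt0 x : 0 < (pr x)%:R :> R. Proof. by rewrite ltr0n prime_gt0. Qed.

Let XexpR_le j : (j < B)%N -> X * expR (kappa j.+1) <= expR ((1 + eta) * l).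
Proof.
move=> jB; rewrite mulrDl mul1r expRD ler_pM ?expR_ge0 ?(ltW X_gt0) //.
by rewrite ler_expR kappa_top.
Qed.

Let pr_le x : (pr x)%:R <= expR ((1 + eta) * l).
Proof. by have [_ _ h] := P_spec x; apply: le_trans h (XexpR_le _). Qed.

Let recip_sum j := \sum_(x | b x == j) (pr x)%:R^-1 : R.

(** About [eta * kappa j / l], as all primes of the block have logarithm
    at most [(1 + eta) * l]; the error 6 in Mertens' theorem is absorbed by
    [eta] times [eta * kappa j]. *)
Let recip_sum_ge (j : 'I_B) : (1 - eta) * eta * kappa j / ((1 + eta) * l) <= recip_sum j.
Proof.
set u := X * expR (kappa j); set v := X * expR (kappa j.+1).
have kk : kappa j <= kappa j.+1 by exact: kappa_mono.
have u1 : 1 <= u.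
  rewrite -[leLHS]mulr1 ler_pM //.
  by rewrite -expR0 ler_expR ltW.
have uv : u <= v by rewrite ler_wpM2l ?ler_expR // ltW.
have v0 : 0 < v := lt_le_trans (lt_le_trans ltr01 u1) uv.
have lnXe i : ln (X * expR (kappa i)) = ln X + kappa i.
  by rewrite lnM ?posrE ?expR_gt0 // expRK.
have := mertens_interval u1 uv; rewrite {1}/v {1}/u !lnXe.
have lv : ln v <= (1 + eta) * l.
  rewrite -[leRHS]expRK ler_ln ?posrE ?expR_gt0 ?XexpR_le //.
move=> H; rewrite ler_pdivrMr; last by rewrite mulr_gt0 // (lt_le_trans _ omega_ge1).
apply: (@le_trans _ _ (\sum_(0 <= p < (Num.truncn v).+1 | prime p && (u < p%:R)) ln p%:R / p%:R)).
  apply: le_trans H; have := kappa_ge j; rewrite kappaS.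
  have : 6 <= eta * eta * kappa j; last by lra.
  have -> : 6 = eta * eta * (6 * kR ^+ 2) :> R.
    have -> : eta * eta * (6 * kR ^+ 2) = (eta * kR) * (eta * kR) * 6 by ring.
    by rewrite eta_k !mul1r.
  by rewrite ler_wpM2l ?(le_trans base_large) ?kappa_ge // mulr_ge0 // ltW.
have vN : ((Num.truncn v).+1 <= N)%N.
  rewrite ltnS le_truncn // (le_trans (XexpR_le (ltn_ord j))) // ler_expR ler_wpM2r ?(ltW l_gt0) //.
  by eta_facts; lra.
rewrite /recip_sum mulr_suml.
rewrite -(big_sub_cond block_primes (fun z => z.1 == j) (fun z => z.2%:R^-1 * ((1 + eta) * l))) /=.
pose F (z : 'I_B * 'I_N) : R := (z.2%:R^-1 * ((1 + eta) * l)).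
have -> : \sum_(i in block_primes | i.1 == j) i.2%:R^-1 * ((1 + eta) * l) =
   \sum_(i < N | (j, i) \in block_primes) F (j, i).
  rewrite (eq_bigl (fun z => (z.1 == j) && ((z.1, z.2) \in block_primes))) => [|[i p]]; last first.
    by rewrite andbC.
  rewrite -(pair_big_dep (fun i => i == j) (fun i p => (i, p) \in block_primes) (fun i p => F (i, p))) /=.
  by rewrite big_pred1_eq.
rewrite big_mkord (big_ord_widen_cond N (fun p => prime p && (u < p%:R)) (fun p => ln p%:R / p%:R)) //.
rewrite [leLHS]big_mkcond [leRHS]big_mkcond; apply: ler_sum => p _.
rewrite inE /= -/u -/v ltnS; case: (boolP (prime p)) => //= pp.
case: (u < p%:R) => //=.
have -> : (p <= Num.truncn v)%N = (p%:R <= v) by rewrite truncn_ge_nat // (le_trans _ uv) // (le_trans _ u1).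
have p0 : 0 < p%:R :> R by rewrite ltr0n prime_gt0.
case: ifP => // pv; rewrite mulrC ler_wpM2l ?invr_ge0 ?(ltW p0) //.
by apply: le_trans lv; rewrite ler_ln ?posrE // (lt_le_trans p0).
Qed.

Let recip_sum_gt (j : 'I_B) : l^-1 <= recip_sum j.
Proof.
apply: le_trans (recip_sum_ge j); rewrite ler_pdivlMr; last by rewrite mulr_gt0 // (lt_le_trans _ omega_ge1).
rewrite mulrCA mulVf ?gt_eqF // mulr1.
have h : 24 <= eta * kappa j.
  have := ler_wpM2l (ltW eta_gt0) (le_trans base_large (kappa_ge j)).
  have -> : eta * (6 * kR ^+ 2) = (eta * kR) * (6 * kR) by ring.
  by rewrite eta_k; have := k0; lra.
by rewrite -mulrA; have := eta_le; have := eta_gt0; nra.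
Qed.

Let recip_sum_gt0 j : 0 < recip_sum j.
Proof. by apply: lt_le_trans (recip_sum_gt j); rewrite invr_gt0. Qed.

Let card_block (j : 'I_B) : #|[pred x | b x == j]|%:R <= X * expR (kappa j.+1).
Proof.
set v := X * _; have v0 : 0 <= v by rewrite mulr_ge0 ?expR_ge0 // ltW.
apply: (@le_trans _ _ (Num.truncn v)%:R); last by rewrite truncn_le.
rewrite ler_nat cardE -(size_map pr) -(size_iota 1 (Num.truncn v)).
apply: uniq_leq_size; first by rewrite map_inj_uniq ?enum_uniq.
move=> p /mapP[x]; rewrite mem_enum inE => /eqP xj ->.
rewrite mem_iota (prime_gt0 (pr_prime x)) add1n ltnS truncn_ge_nat //.
by have [_ _] := P_spec x; rewrite xj.
Qed.

Let recip_sum_le (j : 'I_B) : recip_sum j <= expR (l / 2).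
Proof.
have Xe : 0 < X * expR (kappa j) by rewrite mulr_gt0 ?expR_gt0.
apply: (@le_trans _ _ (\sum_(x | b x == j) (X * expR (kappa j))^-1)).
  apply: ler_sum => x /eqP xj; rewrite lef_pV2 ?posrE //.
  by have [_ h _] := P_spec x; rewrite -xj ltW.
rewrite sumr_const -[leLHS]mulr_natl ler_pdivrMr // (le_trans (card_block j)) //.
rewrite mulrCA ler_wpM2l ?(ltW X_gt0) // -expRD ler_expR.
have := kappa_top (ltn_ord j); have := kappa_gt0 j; have := eta_le; have := l_gt0; nra.
Qed.

(** The expected number of excited primes, chosen such that
    [nj j * kappa j.+1], the cost of block [j] in the logarithm of the size of
    the support, is the same for all blocks. The [r p] are proportional to
    [p ^ (-1/2)] within a block, as for equality in Cauchy-Schwarz. *)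
Let nj (j : 'I_B) : R := locked ((1 - 2 * eta) * L / (B%:R * kappa j.+1)).
Let njE j : nj j = (1 - 2 * eta) * L / (B%:R * kappa j.+1).
Proof. by rewrite /nj -lock. Qed.
Let r (x : P) : R := Num.sqrt (nj (b x) / (2 * (pr x)%:R * recip_sum (b x))).
Let nu (j : 'I_B) : R := (1 + eta) * nj j.

Let BR_ge1 : 1 <= (B%:R : R). Proof. by rewrite ler1n. Qed.
Let BR_gt0 : 0 < (B%:R : R). Proof. by rewrite ltr0n. Qed.
Let Bkappa_gt0 j : 0 < B%:R * kappa j. Proof. by rewrite mulr_gt0. Qed.
Let twoeta : 1 / 2 <= 1 - 2 * eta. Proof. by have := eta_le; lra. Qed.
Let nj_gt0 j : 0 < nj j.
Proof. by rewrite njE divr_gt0 // mulr_gt0 // (lt_le_trans _ twoeta). Qed.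

Let nj_le j : nj j <= L.
Proof.
rewrite njE ler_pdivrMr //; have h : 1 <= B%:R * kappa j.+1.
  by rewrite -[leLHS]mulr1 ler_pM // (le_trans _ (kappa_ge96 _)) // ler1n.
have : L <= L * (B%:R * kappa j.+1) by rewrite ler_peMr // ltW.
by have := eta_gt0; have := L_gt0; nra.
Qed.

Let L_sqr : L = expR (l / 2) * expR (l / 2).
Proof. by rewrite -expRD -splitr. Qed.

Let nj_ge j : 128 * kR ^+ 2 * expR (l / 2) <= nj j.
Proof.
rewrite njE ler_pdivlMr //; set s := expR (l / 2).
have s0 : 0 < s by exact: expR_gt0.
have h : B%:R * kappa j.+1 <= l * l.
  apply: ler_pM; rewrite ?ler0n ?(ltW (kappa_gt0 _)) //.
    by have := B_le; have := eta_le; have := l_gt0; nra.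
  by apply: le_trans (kappa_top (ltn_ord j)) _; have := eta_le; have := l_gt0; nra.
have e : 128 * kR ^+ 2 * s * (B%:R * kappa j.+1) <= 128 * kR ^+ 2 * s * (l * l).
  by rewrite ler_wpM2l // !mulr_ge0 ?sqr_ge0 // ltW.
apply: le_trans e _; rewrite L_sqr -/s.
have := ler_wpM2l (ltW s0) sqrt_large; rewrite -/s => h2.
have : 1 / 2 * (s * s) <= (1 - 2 * eta) * (s * s) by rewrite ler_wpM2r ?mulr_ge0 ?(ltW s0).
by apply: le_trans; move: h2; lra.
Qed.

Let r_ge0 x : 0 <= r x. Proof. exact: sqrtr_ge0. Qed.

Let r_sqr x : r x ^+ 2 = nj (b x) / (2 * recip_sum (b x)) / (pr x)%:R.
Proof.
rewrite sqr_sqrtr; last by rewrite divr_ge0 ?(ltW (nj_gt0 _)) // !mulr_ge0 // ltW.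
by rewrite [2 * _ * _]mulrAC invfM mulrA.
Qed.

Let mass_eq j : mass b r j = nj j.
Proof.
rewrite /mass (eq_bigr (fun x => nj j / recip_sum j * (pr x)%:R^-1)) => [|x /eqP xj].
  by rewrite -mulr_sumr mulfVK // gt_eqF.
by rewrite r_sqr xj; field; rewrite !gt_eqF.
Qed.

Let gain_eq j : gain pr b r j = 2 * Num.sqrt (nj j / (2 * recip_sum j)) * recip_sum j.
Proof.
rewrite /gain {2}/recip_sum mulr_sumr; apply: eq_bigr => x /eqP xj.
rewrite -!mulrA; congr (_ * _).
have -> : r x = Num.sqrt (nj j / (2 * recip_sum j)) * Num.sqrt (pr x)%:R^-1.
  rewrite -sqrtrM ?divr_ge0 ?mulr_ge0 ?(ltW (nj_gt0 _)) ?(ltW (recip_sum_gt0 _)) //.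
  by rewrite /r xj; congr Num.sqrt; rewrite [2 * _ * _]mulrAC invfM mulrA.
rewrite -mulrA; congr (_ * _); rewrite /invsqrt sqrtrV ?(ltW (pr_gt0 x)) //.
by rewrite -invfM -expr2 sqr_sqrtr // ltW.
Qed.

Let gain_ge0 j : 0 <= gain pr b r j.
Proof. by rewrite gain_eq !mulr_ge0 ?sqrtr_ge0 // ltW. Qed.

(** So the gain of a block is at least about
    [sqrt (2 * (L / (B * kappa j)) * (eta * kappa j / l))]: it does not depend
    on [j], and [B] blocks give [sqrt (2 * L * (B * eta) / l)] in total. *)
Let gain_sqr j : gain pr b r j ^+ 2 = 2 * nj j * recip_sum j.
Proof.
rewrite gain_eq !exprMn sqr_sqrtr; last by rewrite divr_ge0 ?mulr_ge0 // ltW.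
by field; rewrite gt_eqF.
Qed.

Let k_sqr_eta : eta ^+ 2 * kR ^+ 2 = 1. Proof. by rewrite -exprMn eta_k expr1n. Qed.

Let gain_le_mass j : gain pr b r j <= nj j * eta / 8.
Proof.
have S2 := recip_sum_le j; set s := expR (l / 2) in S2.
rewrite -(@ler_pXn2r _ 2) ?nnegrE ?gain_ge0 //; last first.
  by rewrite !mulr_ge0 // ltW.
rewrite gain_sqr; have h := ler_wpM2l (sqr_ge0 eta) (nj_ge j).
have e : eta ^+ 2 * (128 * kR ^+ 2 * s) = 128 * s.
  have -> : eta ^+ 2 * (128 * kR ^+ 2 * s) = (eta ^+ 2 * kR ^+ 2) * (128 * s) by ring.
  by rewrite k_sqr_eta mul1r.
rewrite -/s e in h.
have {}h : 128 * recip_sum j <= eta ^+ 2 * nj j by lra.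
have := ler_wpM2l (ltW (nj_gt0 j)) h; rewrite -mulrA !exprMn; lra.
Qed.

Let gain_le j : gain pr b r j <= 2 * expR (3 / 4 * l).
Proof.
rewrite -(@ler_pXn2r _ 2) ?nnegrE ?gain_ge0 ?mulr_ge0 ?expR_ge0 //.
rewrite gain_sqr exprMn; have -> : expR (3 / 4 * l) ^+ 2 = L * expR (l / 2).
  by rewrite expr2 -!expRD; congr expR; field.
have := ler_pM (ltW (nj_gt0 j)) (ltW (recip_sum_gt0 j)) (nj_le j) (recip_sum_le j).
have := mulr_gt0 L_gt0 (expR_gt0 (l / 2)); lra.
Qed.

Let total_gain_eq : total_gain pr r = \sum_j gain pr b r j.
Proof. by rewrite /total_gain (partition_big b xpredT). Qed.

Let total_gain_le : total_gain pr r <= l * expR (3 / 4 * l).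
Proof.
rewrite total_gain_eq; apply: (@le_trans _ _ (\sum_(j < B) 2 * expR (3 / 4 * l))).
  by apply: ler_sum => j _; apply: gain_le.
rewrite sumr_const card_ord -[leLHS]mulr_natl mulrA ler_wpM2r ?expR_ge0 //.
by have := B_le; have := eta_le; have := l_gt0; nra.
Qed.

Let target_gain := Num.sqrt 2 * ((1 - 2 * eta) * (1 - eta) / (1 + eta)) * Num.sqrt (L * ln l / l).

Let total_gain_ge : target_gain <= total_gain pr r.
Proof.
set c := (1 - 2 * eta) * (1 - eta) / (1 + eta).
have eta1 : 0 < 1 - eta by have := eta_le; lra.
have eta2 : 0 < 1 - 2 * eta by have := eta_le; lra.
have omega0 : 0 < 1 + eta := lt_le_trans ltr01 omega_ge1.
have lnl0 : 0 < ln l := lt_le_trans ltr01 ln_l_ge1.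
have c0 : 0 < c by rewrite divr_gt0 ?mulr_gt0.
rewrite total_gain_eq.
suff H j : target_gain / B%:R <= gain pr b r j.
  apply: (@le_trans _ _ (\sum_(j < B) target_gain / B%:R)); last by apply: ler_sum.
  by rewrite sumr_const card_ord -[leRHS]mulr_natr mulfVK // gt_eqF.
rewrite -(@ler_pXn2r _ 2) ?nnegrE ?gain_ge0 //; last first.
  by rewrite divr_ge0 // (mulr_ge0 (mulr_ge0 (sqrtr_ge0 _) (ltW c0)) (sqrtr_ge0 _)).
rewrite gain_sqr /target_gain -/c exprMn !exprMn !sqr_sqrtr //; last first.
  by rewrite divr_ge0 ?mulr_ge0 // ltW.
have key : (1 - 2 * eta) * ((1 - eta) * ln l) <= B%:R * eta.
  by rewrite B_eta ler_wpM2l // ltW.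
apply: (@le_trans _ _ (2 * nj j * ((1 - eta) * eta * kappa j / ((1 + eta) * l)))); last first.
  by rewrite ler_wpM2l ?recip_sum_ge // mulr_ge0 // ltW.
have -> : 2 * nj j * ((1 - eta) * eta * kappa j / ((1 + eta) * l)) =
   2 * (1 - 2 * eta) * (1 - eta) * L / ((1 + eta) ^+ 2 * l * B%:R ^+ 2) * (B%:R * eta).
  by rewrite njE kappaS; field; rewrite !gt_eqF.
have -> : 2 * ((1 - 2 * eta) ^+ 2 * (1 - eta) ^+ 2 * (1 + eta)^-1 ^+ 2) *
   (L * ln l / l) * B%:R^-1 ^+ 2 =
   2 * (1 - 2 * eta) * (1 - eta) * L / ((1 + eta) ^+ 2 * l * B%:R ^+ 2) *
    ((1 - 2 * eta) * ((1 - eta) * ln l)).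
  by field; rewrite !gt_eqF.
apply: ler_wpM2l key; rewrite divr_ge0 ?mulr_ge0 ?sqr_ge0 // ltW //.
Qed.

Let exp_base_small : (l ^+ 2 + 1) * expR (- (1 + eta) ^+ T) <= eta / 4.
Proof.
rewrite expRN ler_pdivrMr ?expR_gt0 //.
have := ler_wpM2l (ltW eta_gt0) exp_base_large.
have -> : eta * (4 * kR * (l ^+ 2 + 1)) = (eta * kR) * (4 * (l ^+ 2 + 1)) by ring.
by rewrite eta_k mul1r; lra.
Qed.

Let pr_inv_le x : (pr x)%:R^-1 <= X^-1 * expR (- (1 + eta) ^+ T).
Proof.
have [_ h _] := P_spec x; rewrite expRN -invfM lef_pV2 ?posrE ?(mulr_gt0 X_gt0 (expR_gt0 _)) //.
by apply: le_trans (ltW h); rewrite ler_wpM2l ?(ltW X_gt0) // ler_expR.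
Qed.

(** This is what the factor [X = L / l] in the size of the primes is for.
    Since [nj j <= L], the reciprocal sum is at least [1 / l], and the prime is
    at least [X * exp (kappa j)], [2 * r x ^ 2 <= l ^ 2 * exp (- kappa j)]. *)
Let small x : 2 * r x ^+ 2 + 2 * r x * invsqrt R (pr x) <= eta.
Proof.
set e := expR (- (1 + eta) ^+ T); have e0 : 0 <= e by exact: expR_ge0.
have h := exp_base_small; rewrite -/e mulrDl mul1r in h.
have p_inv : (pr x)%:R^-1 <= e.
  apply: le_trans (pr_inv_le x) _; rewrite ler_piMl //.
  by rewrite invf_le1.
have hr : 2 * r x ^+ 2 <= l ^+ 2 * e.
  have -> : 2 * r x ^+ 2 = nj (b x) * (recip_sum (b x))^-1 * (pr x)%:R^-1.
    by rewrite r_sqr; field; rewrite !gt_eqF.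
  apply: (@le_trans _ _ (L * l * (X^-1 * e))); last first.
    by rewrite /X invf_div le_eqVlt; apply/orP; left; apply/eqP; field; rewrite gt_eqF.
  apply: ler_pM (pr_inv_le x); rewrite ?invr_ge0 ?mulr_ge0 ?invr_ge0 ?(ltW (nj_gt0 _)) //
    ?(ltW (recip_sum_gt0 _)) ?(ltW (pr_gt0 _)) //.
  apply: ler_pM; rewrite ?invr_ge0 ?(ltW (nj_gt0 _)) ?(ltW (recip_sum_gt0 _)) ?nj_le //.
  by rewrite -[leRHS]invrK lef_pV2 ?posrE ?invr_gt0.
have c2 : invsqrt R (pr x) ^+ 2 = (pr x)%:R^-1 by rewrite /invsqrt exprVn sqr_sqrtr // ltW.
have := sqr_ge0 (r x - invsqrt R (pr x)); rewrite sqrrB c2.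
have := eta_gt0; move: hr p_inv h; rewrite -mulr_natl; have := mulr_ge0 (sqr_ge0 l) e0; lra.
Qed.

Let tail_exponent j :
  (expR (eta / 2) - 1) * (mass b r j + gain pr b r j / 2) - eta / 2 * nu j <= - (16 * expR (l / 2)).
Proof.
rewrite mass_eq /nu; apply: tilted_exponent_le; rewrite ?gain_ge0 ?gain_le_mass ?expR_ge0 //.
have := ler_wpM2r (sqr_ge0 eta) (nj_ge j).
have -> : 128 * kR ^+ 2 * expR (l / 2) * eta ^+ 2 = (eta ^+ 2 * kR ^+ 2) * (128 * expR (l / 2)) by ring.
by rewrite k_sqr_eta mul1r.
Qed.

(** The shift 6 in [y] makes the tail for the number of rises at most
    [exp (- 3) <= 1 / 4]. *)
Let tails_small y : y = 2 * total_gain pr r + 6 ->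
  1 / 2 <= 1 - (\sum_j 2 * expR ((expR (eta / 2) - 1) * (mass b r j + gain pr b r j / 2) - eta / 2 * nu j))
    - expR (total_gain pr r - y / 2).
Proof.
move=> ->.
have -> : total_gain pr r - (2 * total_gain pr r + 6) / 2 = - 3 by field.
have h3 : expR (- 3 : R) <= 1 / 4.
  by rewrite expRN div1r lef_pV2 ?posrE ?expR_gt0 //; have := @expR_ge1Dx R 3; lra.
have sl : l <= expR (l / 2).
  apply: le_trans sqrt_large; have := k0; have := l_ge1 => l1 kk.
  have h : 1 <= kR ^+ 2 by rewrite exprn_ege1 //; lra.
  have : l * 1 <= l * l by rewrite ler_wpM2l //; lra.
  rewrite -mulrA => ll; apply: (@le_trans _ _ (256 * (1 * l ^+ 2))); first by rewrite expr2; lra.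
  by rewrite ler_wpM2l // ler_wpM2r // sqr_ge0.
have : \sum_j 2 * expR ((expR (eta / 2) - 1) * (mass b r j + gain pr b r j / 2) - eta / 2 * nu j) <=
    \sum_(j < B) 2 * expR (- (16 * expR (l / 2))).
  by apply: ler_sum => j _; rewrite ler_wpM2l // ler_expR tail_exponent.
rewrite sumr_const card_ord -[X in _ <= X -> _]mulr_natl.
have : B%:R * (2 * expR (- (16 * expR (l / 2)))) <= 1 / 4; last by lra.
set s := expR (l / 2) in sl *; have l1 := l_ge1.
rewrite expRN mulrA ler_pdivrMr ?expR_gt0 //.
have := @expR_ge1Dx R (16 * s); have := B_le; have := eta_le; nra.
Qed.

Let A := Num.truncn (expR L).

Let two_l_le : 2 * l * (2 * total_gain pr r + 6) <= L.
Proof.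
apply: le_trans L_large; have h := ler_wpM2l (ltW l_gt0) total_gain_le.
have : 0 <= l * (l * expR (3 / 4 * l)) by rewrite !mulr_ge0 ?expR_ge0 // ltW.
move: (total_gain pr r) h => x h; rewrite expr2; lra.
Qed.

Let multiplier_le (F : {ffun P -> 'I_3 * bool}) :
  (move_size F)%:R <= 2 * total_gain pr r + 6 -> (multiplier pr F <= A)%N.
Proof.
move=> sz; rewrite truncn_ge_nat ?expR_ge0 // /multiplier natr_prod.
apply: (@le_trans _ _ (\prod_(x | (F x).2) expR (2 * l))).
  apply: ler_prod => x _; rewrite ler0n /=; apply: le_trans (pr_le x) _.
  by rewrite ler_expR ler_wpM2r ?(ltW l_gt0) //; have := eta_le; lra.
rewrite prodr_const -expRM_natl ler_expR -/(move_size F).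
apply: le_trans two_l_le; rewrite mulrC.
apply: ler_wpM2l sz; rewrite mulr_ge0 // ltW //.
Qed.

(** Each block costs [nu j * kappa j.+1], which is
    [(1 + eta) * (1 - 2 * eta) * L / B], and the additional
    [2 * exp (- kappa) * |block| <= 2 * X] from Rankin's trick amounts to
    at most [eta * L] over all blocks. *)
Let card_le : #|resonator_set b nu|%:R <= expR L.
Proof.
apply: le_trans (@card_resonator_set R P B b nu (fun j => kappa j.+1) _) _.
  by move=> j; apply: ltW.
rewrite ler_expR; apply: (@le_trans _ _ (\sum_(j < B) ((1 + eta) * (1 - 2 * eta) * L / B%:R + 2 * X))).
  apply: ler_sum => j _; apply: lerD.
    rewrite /nu njE le_eqVlt; apply/orP; left; apply/eqP; field; by rewrite !gt_eqF.
  rewrite -mulrA ler_wpM2l // expRN mulrC ler_pdivrMr ?expR_gt0 //; exact: card_block.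
rewrite sumr_const card_ord -[leLHS]mulr_natl mulrDr mulrC mulfVK ?gt_eqF //.
have h : B%:R * (2 * X) <= eta * L.
  rewrite /X; have -> : B%:R * (2 * (L / l)) = (2 * B%:R) * (L / l) by ring.
  have -> : eta * L = (eta * l) * (L / l) by field; rewrite gt_eqF.
  by apply: ler_wpM2r; [rewrite divr_ge0 // ltW | have := B_le; lra].
have : (1 + eta) * (1 - 2 * eta) * L <= (1 - eta) * L.
  by apply: ler_wpM2r; [exact: ltW | have := eta_gt0; nra].
lra.
Qed.

(** The integers [a] stay below [exp L] because a typical move has about
    [total_gain] rises, which is at most [L ^ (3 / 4 + o(1))], and each rise
    multiplies by a prime of size [exp (O(l))]. The loss [- 1] in the exponent
    pays for the tails, which take away at most half of the weight. *)
Lemma resonator_of_blocks :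
  exists (I : finType) (M : {set I}) (n : I -> nat) (f : I -> R),
  [/\ injective n /\ (forall q, prime q -> expR L <= q%:R -> forall i, coprime q (n i)),
      forall i, 0 <= f i, 0 < \sum_(i in M) f i ^+ 2, #|M|%:R <= expR L &
      expR ((1 - eta) * target_gain - 1) * \sum_(i in M) f i ^+ 2 <=
      \sum_(1 <= a < (Num.truncn (expR L)).+1) invsqrt R a *
        \sum_(i in M) \sum_(j in M | n j == (a * n i)%N) f i * f j].
Proof.
exists {ffun P -> 'I_3}, (resonator_set b nu), (integer pr), (coefficient r); split.
- split; first exact: integer_inj.
  move=> q pq Lq m; apply: integer_coprime => // x; rewrite -(ltr_nat R).
  apply: lt_le_trans Lq; apply: le_lt_trans (pr_le x) _; rewrite ltr_expR.
  have := L_large; rewrite -/L; have := expR_gt0 (3 / 4 * l); set e := expR _ => ee.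
  have := mulr_ge0 (sqr_ge0 l) (ltW ee); have := eta_le; have := l_gt0; nra.
- by move=> m; apply: coefficient_ge0.
- pose m0 : {ffun P -> 'I_3} := [ffun=> inord 1].
  rewrite (bigD1 m0) /=; last first.
    rewrite inE; apply/forallP => j; rewrite /excitation eq_card0 => [|x].
      by rewrite mulr_ge0 ?(ltW (nj_gt0 j)) // (le_trans _ omega_ge1).
    by rewrite !inE ffunE /excited inordK // andbF.
  have -> : coefficient r m0 = 1.
    by rewrite /coefficient big1 // => x _; rewrite ffunE /amplitude /excited inordK.
  by rewrite expr1n ltr_wpDr // sumr_ge0 // => m _; apply: sqr_ge0.
- exact: card_le.
apply: le_trans (sum_move_weight_le b nu pr_prime r_ge0 multiplier_le).
have tau0 : 0 <= eta / 2 by rewrite divr_ge0 // ltW.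
apply: le_trans (good_moves_bound pr b nu r_ge0 (2 * total_gain pr r + 6) tau0).
have full0 := full_gt0 pr r_ge0.
apply: (@le_trans _ _ (full pr r * (1 / 2))); last first.
  by rewrite ler_wpM2l ?(ltW full0) // tails_small.
have H := full_ge r_ge0 (ltW eta_gt0) small.
apply: (@le_trans _ _ ((\sum_m coefficient r m ^+ 2) * expR ((1 - eta) * total_gain pr r) * (1 / 2))).
  rewrite -[leRHS]mulrA [leLHS]mulrC; apply: ler_pM; rewrite ?expR_ge0 //.
  - by apply: sumr_ge0 => m _; apply: sqr_ge0.
  - rewrite [leRHS](bigID (mem (resonator_set b nu))) /= lerDl.
    by apply: sumr_ge0 => m _; apply: sqr_ge0.
  - have e1 : expR (- 1 : R) <= 1 / 2.
      by rewrite expRN div1r lef_pV2 ?posrE ?expR_gt0 //; have := @expR_ge1Dx R 1; lra.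
    rewrite expRD; apply: ler_pM; rewrite ?expR_ge0 // ler_expR.
    by rewrite ler_wpM2l ?total_gain_ge // subr_ge0 (le_trans eta_le) // ler_pdivrMr // mul1r ler1n.
by rewrite ler_wpM2r.
Qed.

End Blocks.

(** * Existence of the resonator *)

Section LargeParameters.
Variables (R : realType) (k : nat).
Hypothesis k_ge4 : (4 <= k)%N.
Implicit Types l x : R.

Lemma bernoulli x n : 0 <= x -> 1 + n%:R * x <= (1 + x) ^+ n.
Proof.
move=> x0; elim: n => [|n IH]; first by rewrite mul0r addr0.
rewrite exprS -natr1; have := ler_wpM2l (_ : 0 <= 1 + x) IH.
have nx : 0 <= n%:R * x by rewrite mulr_ge0.
move=> /(_ ltac:(lra)); nra.
Qed.

Lemma expR_ge_pow n x : 0 <= x -> x ^+ n.+1 / (n.+1)`!%:R <= expR x.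
Proof. by move=> x0; apply: le_trans (expR_ge1Dxn n x0); rewrite lerDr. Qed.

(** [T] is the largest integer with [(1 + eta) ^ (k * T) <= l]. The second
    bound uses [ln (1 + eta) <= eta], and the last one says that [l] exceeds
    [(1 + eta) ^ (k * T)] by a bounded factor. *)
Lemma block_parameter_spec l : let T := Num.truncn (ln l / (k%:R * ln (1 + k%:R^-1))) in
  k%:R <= ln l ->
  [/\ (1 + k%:R^-1) ^+ (k * T) <= l, (1 - k%:R^-1) * ln l <= T%:R &
      l <= 4 * ((1 + k%:R^-1) ^+ T) ^+ k].
Proof.
have k4 : 4 <= k%:R :> R by rewrite ler_nat.
set eta := k%:R^-1; have eta0 : 0 < eta by rewrite invr_gt0; lra.
have ek : eta * k%:R = 1 by rewrite mulVf //; lra.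
set lw := ln (1 + eta); have lw0 : 0 < lw by rewrite ln_gt0 //; lra.
have lw1 : lw <= eta by apply: le_ln1Dx; lra.
move=> T kl; have l0 : 0 < l.
  by rewrite ltNge; apply/negP => /ln0 E; move: kl; rewrite E; lra.
have klw : 0 < k%:R * lw by rewrite mulr_gt0 //; lra.
have klw1 : k%:R * lw <= 1 by rewrite -[leRHS]ek [leRHS]mulrC ler_wpM2l //; lra.
have q0 : 0 <= ln l / (k%:R * lw) by rewrite divr_ge0 //; lra.
have /andP[T1 T2] := truncn_itv q0; rewrite -/T in T1 T2.
have wE n : (1 + eta) ^+ n = expR (n%:R * lw).
  by rewrite expRM_natl lnK // posrE; lra.
split.
- rewrite wE -[leRHS]lnK ?posrE // ler_expR natrM.
  by move: T1; rewrite ler_pdivlMr //; lra.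
- rewrite ltr_pdivrMr // -natr1 in T2.
  have h : (T%:R + 1) * (k%:R * lw) <= T%:R + 1 by rewrite ler_piMr // addr_ge0.
  have : 1 <= eta * ln l by rewrite -[leLHS]ek ler_wpM2l //; lra.
  lra.
- rewrite -exprM wE natrM -[leLHS]lnK ?posrE //.
  rewrite ltr_pdivrMr // -natr1 in T2.
  apply: (@le_trans _ _ (expR (1 + T%:R * k%:R * lw))).
    by rewrite ler_expR; lra.
  rewrite expRD ler_wpM2r ?expR_ge0 //.
  (* [exp 1 <= 4], since [1 / 2 <= exp (- (1 / 2))]. *)
  have h := @expR_ge1Dx R (- (1 / 2)); have h2 : expR (1 / 2 : R) ^+ 2 = expR 1.
    by rewrite -expRM_natl; congr expR; lra.
  rewrite -h2; rewrite expRN in h; set e := expR (1 / 2) in h h2 *.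
  have e0 : 0 < e by exact: expR_gt0.
  have {}h : 1 / 2 * e <= 1 by rewrite -ler_pdivlMr // div1r; lra.
  rewrite expr2; nra.
Qed.

Lemma sqr_le_expR_half l : (120 * k%:R) ^+ 2 <= l -> 256 * k%:R ^+ 2 * l ^+ 2 <= expR (l / 2).
Proof.
move=> lk; have l0 : 0 <= l by apply: le_trans lk; apply: sqr_ge0.
apply: le_trans (expR_ge_pow 2 (_ : 0 <= l / 2)); last by rewrite divr_ge0.
have -> : (l / 2) ^+ 3 / 3`!%:R = l * l ^+ 2 / 48 by rewrite (_ : 3`! = 6)%N //; field.
rewrite ler_pdivlMr //; have := ler_wpM2r (sqr_ge0 l) lk.
have -> : (120 * k%:R) ^+ 2 * l ^+ 2 = 120 * 120 * (k%:R ^+ 2 * l ^+ 2) :> R by ring.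
have -> : 256 * k%:R ^+ 2 * l ^+ 2 * 48 = 256 * 48 * (k%:R ^+ 2 * l ^+ 2) :> R by ring.
have := mulr_ge0 (sqr_ge0 k%:R) (sqr_ge0 l); move: (k%:R ^+ 2 * l ^+ 2) (l * l ^+ 2) => z w.
by clear; lra.
Qed.

Lemma sqr_expR_le l : 120 * 120 <= l -> 8 * l ^+ 2 * expR (3 / 4 * l) + 12 * l <= expR l.
Proof.
move=> l1; have l0 : 0 < l by apply: lt_le_trans l1; rewrite mulr_gt0.
have -> : expR l = expR (l / 4) * expR (3 / 4 * l) by rewrite -expRD; congr expR; field.
have e1 : 1 <= expR (3 / 4 * l).
  by rewrite -[leLHS]expR0 ler_expR mulr_ge0 ?(ltW l0).
apply: (@le_trans _ _ ((8 * l ^+ 2 + 12 * l) * expR (3 / 4 * l))).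
  by rewrite [leRHS]mulrDl lerD2l ler_peMr // mulr_ge0 // ltW.
rewrite ler_wpM2r ?expR_ge0 //.
apply: le_trans (expR_ge_pow 2 (_ : 0 <= l / 4)); last by rewrite divr_ge0 // ltW.
have -> : (l / 4) ^+ 3 / 3`!%:R = l * l ^+ 2 / (64 * 6) by rewrite (_ : 3`! = 6)%N //; field.
rewrite ler_pdivlMr // [X in X <= _]mulrC; have := ler_wpM2r (sqr_ge0 l) l1.
have h : 120 * 120 * l <= l ^+ 2 by rewrite expr2; apply: ler_wpM2r l1; apply: ltW.
move: h (sqr_ge0 l) l0; move: (l ^+ 2) (l * l ^+ 2) => z w; clear; lra.
Qed.

(** A lower bound for [(1 + eta) ^ T] that makes the Taylor term of degree
    [2 k + 1] of [exp ((1 + eta) ^ T)] larger than [4 k (l ^ 2 + 1)]. *)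
Let C : R := 128 * k%:R * (k.*2.+1)`!%:R + 6 * k%:R ^+ 2.
(** The first term ensures [C <= (1 + eta) ^ T]. *)
Definition log_threshold : R := Num.max (expR (2 * k%:R * C)) ((120 * k%:R) ^+ 2).

(** With [t = (1 + eta) ^ T], [l] lies between [t ^ k] and [4 t ^ k], and [t]
    is as large as desired, so that each requirement on the blocks becomes a
    comparison of powers of [t] or of exponentials with powers. *)
Lemma resonator_of_large_log l : log_threshold <= l ->
  exists (I : finType) (M : {set I}) (n : I -> nat) (f : I -> R),
  [/\ injective n /\ (forall q, prime q -> expR (expR l) <= q%:R -> forall i, coprime q (n i)),
      forall i, 0 <= f i, 0 < \sum_(i in M) f i ^+ 2, #|M|%:R <= expR (expR l) &
      expR (Num.sqrt 2 * (1 - 5 / k%:R) * Num.sqrt (expR l * ln l / l) - 1) * \sum_(i in M) f i ^+ 2 <=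
      \sum_(1 <= a < (Num.truncn (expR (expR l))).+1) invsqrt R a *
        \sum_(i in M) \sum_(j in M | n j == (a * n i)%N) f i * f j].
Proof.
have k4 : 4 <= k%:R :> R by rewrite ler_nat.
rewrite /log_threshold ge_max => /andP[lC l14].
have fact_ge1 : 1 <= (k.*2.+1)`!%:R :> R by rewrite ler1n fact_gt0.
have C1 : 6 * k%:R ^+ 2 <= C by rewrite /C lerDr !mulr_ge0.
have C2 : 128 * k%:R * (k.*2.+1)`!%:R <= C by rewrite /C lerDl mulr_ge0 // sqr_ge0.
have kk : 16 <= k%:R ^+ 2 :> R by rewrite expr2; nra.
have lnC : 2 * k%:R * C <= ln l.
  rewrite -[leLHS]expRK ler_ln ?posrE ?expR_gt0 //.
  by apply: lt_le_trans lC; apply: expR_gt0.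
have kC : k%:R * 16 <= k%:R * C by rewrite ler_wpM2l //; lra.
have kln : k%:R <= ln l by lra.
clearbody C.
have [H1 H2 H3] := block_parameter_spec kln.
move: (Num.truncn _) H1 H2 H3 => T H1 H2 H3.
have [eta etaE] : exists eta : R, k%:R^-1 = eta by exists k%:R^-1.
have k0 : 0 < k%:R :> R by exact: lt_le_trans k4.
have eta0 : 0 < eta by rewrite -etaE invr_gt0.
have ek : eta * k%:R = 1 by rewrite -etaE mulVf // gt_eqF.
have eta4 : eta <= 1 / 4 by rewrite -etaE div1r lef_pV2 ?posrE.
have [t tE] : exists t, (1 + k%:R^-1) ^+ T = t :> R by exists ((1 + k%:R^-1) ^+ T).
rewrite tE in H3.
have tC : C <= t.
  have Tt := bernoulli T (ltW eta0); rewrite -{2}etaE tE in Tt; apply: le_trans Tt.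
  have h : 1 / 2 * ln l <= T%:R.
    by apply: le_trans H2; rewrite etaE; apply: ler_wpM2r; lra.
  have h' := ler_wpM2r (ltW eta0) (le_trans (ler_wpM2l (_ : 0 <= 1 / 2) lnC) h).
  apply: le_trans (le_trans _ (h' _)) _; [|lra|lra].
  have -> : 1 / 2 * (2 * k%:R * C) * eta = (eta * k%:R) * C by field.
  by rewrite ek mul1r.
have l0 : 120 * 120 <= l by apply: le_trans l14; rewrite expr2; nra.
have H4 : 6 * k%:R ^+ 2 <= t by lra.
have t1 : 1 <= t by lra.
have H5 : 2 * k%:R ^+ 2 * T%:R <= l.
  apply: le_trans H1; rewrite mulnC exprM tE.
  have -> : t ^+ k = t * t ^+ 3 * t ^+ (k - 4).
    by rewrite -exprS -exprD subnKC.
  have tk : 1 <= t ^+ (k - 4) by rewrite exprn_ege1.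
  have h1 : T%:R * eta <= t.
    by have := bernoulli T (ltW eta0); rewrite -{2}etaE tE; lra.
  have h2 : 2 * k%:R ^+ 3 <= t ^+ 3.
    have : 6 * k%:R <= t by rewrite (le_trans _ H4) // expr2; nra.
    move=> h; apply: (@le_trans _ _ ((6 * k%:R) ^+ 3)).
      by rewrite exprMn ler_wpM2r ?exprn_ge0 ?ler0n // !exprS expr0; lra.
    by rewrite lerXn2r ?nnegrE //; lra.
  have -> : 2 * k%:R ^+ 2 * T%:R = T%:R * eta * (2 * k%:R ^+ 3) :> R.
    have -> : T%:R * eta * (2 * k%:R ^+ 3) = (eta * k%:R) * (2 * k%:R ^+ 2 * T%:R) :> R by ring.
    by rewrite ek mul1r.
  have h3 : T%:R * eta * (2 * k%:R ^+ 3) <= t * t ^+ 3.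
    by apply: ler_pM => //; rewrite mulr_ge0 // ltW.
  by apply: le_trans h3 _; rewrite ler_peMr // mulr_ge0 ?exprn_ge0 //; lra.
have H6 : 4 * k%:R * (l ^+ 2 + 1) <= expR t.
  have t0 : 0 <= t by lra.
  apply: le_trans (expR_ge_pow k.*2 t0); rewrite ler_pdivlMr ?ltr0n ?fact_gt0 //.
  have h : l ^+ 2 <= 16 * t ^+ k.*2.
    have -> : 16 * t ^+ k.*2 = (4 * t ^+ k) ^+ 2.
      by rewrite exprMn -exprM muln2 expr2; congr (_ * _); lra.
    by rewrite lerXn2r ?nnegrE ?mulr_ge0 ?exprn_ge0 //; lra.
  have tk1 : 1 <= t ^+ k.*2 by rewrite exprn_ege1.
  have h2 : 4 * k%:R * (l ^+ 2 + 1) <= 4 * k%:R * (32 * t ^+ k.*2).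
    by rewrite ler_wpM2l; lra.
  apply: le_trans (ler_wpM2r (ler0n _ _) h2) _.
  have -> : 4 * k%:R * (32 * t ^+ k.*2) * (k.*2.+1)`!%:R =
    (128 * k%:R * (k.*2.+1)`!%:R) * t ^+ k.*2 by ring.
  by rewrite exprS ler_wpM2r ?exprn_ge0 //; lra.
have H7 := sqr_le_expR_half l14; have H8 := sqr_expR_le l0.
have lnl1 : 1 <= ln l by lra.
rewrite -tE in H4 H6.
have [I [M [n [f [h1 h2 h3 h4 h5]]]]] := resonator_of_blocks k_ge4 H1 H2 lnl1 H4 H5 H6 H7 H8.
exists I, M, n, f; split => //; apply: le_trans h5; rewrite ler_wpM2r ?(ltW h3) //.
rewrite ler_expR lerD2r etaE.
move: (Num.sqrt (expR l * ln l / l)) (sqrtr_ge0 (expR l * ln l / l)) => Y Y0.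
rewrite [leRHS](_ : _ =
  Num.sqrt 2 * ((1 - eta) * ((1 - 2 * eta) * (1 - eta) / (1 + eta))) * Y); last by ring.
rewrite ler_wpM2r // ler_wpM2l ?sqrtr_ge0 // mulrA ler_pdivlMr; last by lra.
have e2 := sqr_ge0 eta; have e3 : 0 <= eta ^+ 2 * (1 - eta) by rewrite mulr_ge0 // subr_ge0; lra.
rewrite -subr_ge0.
have -> : (1 - eta) * ((1 - 2 * eta) * (1 - eta)) - (1 - 5 * eta) * (1 + eta) =
  8 * eta ^+ 2 + 2 * (eta ^+ 2 * (1 - eta)) by ring.
by rewrite addr_ge0 // mulr_ge0.
Qed.

End LargeParameters.

Lemma ln_ge1 (R : realType) (l : R) : 4 <= l -> 1 <= ln l.
Proof.
move=> l4; rewrite -[leLHS]expRK ler_ln ?posrE ?expR_gt0 //; last by lra.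
(* [exp 1 <= 4], since [1 / 2 <= exp (- (1 / 2))]. *)
have h := @expR_ge1Dx R (- (1 / 2)); have e2 : expR (1 / 2 : R) ^+ 2 = expR 1.
  by rewrite -expRM_natl; congr expR; lra.
rewrite -e2; rewrite expRN in h; have e0 := expR_gt0 (1 / 2 : R).
move: (expR (1 / 2)) h e0 => e h e0.
have {}h : 1 / 2 * e <= 1 by rewrite -ler_pdivlMr // div1r; lra.
rewrite expr2; nra.
Qed.

(** The right-hand side, with [L = exp l], is the square of the exponent of
    the final bound, which thus tends to infinity. *)
Lemma scale_ge (R : realType) (l : R) : 120 * 120 <= l -> l <= expR l * ln l / l.
Proof.
move=> l5; have ll0 : 0 < l by lra.
have lnl1 : 1 <= ln l by apply: ln_ge1; lra.
rewrite ler_pdivlMr //; have h8 := sqr_expR_le l5.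
have e1 : 1 <= expR (3 / 4 * l) by rewrite -[leLHS]expR0 ler_expR mulr_ge0 // ltW.
have h : l ^+ 2 <= expR l.
  have : l ^+ 2 <= l ^+ 2 * expR (3 / 4 * l) by rewrite ler_peMr // sqr_ge0.
  have := mulr_ge0 (sqr_ge0 l) (expR_ge0 (3 / 4 * l)); move: h8.
  by rewrite -mulrA; move: (l ^+ 2 * expR (3 / 4 * l)) (expR l) (l ^+ 2) => u v w; lra.
by rewrite -expr2; apply: le_trans h _; rewrite ler_peMr // expR_ge0.
Qed.

(** The relative loss [5 / k] is made smaller than [delta / 4] by the choice
    of [k], and the loss [- 1] is absorbed since the exponent tends to
    infinity. *)
Theorem resonator_exists (R : realType) (delta : R) : 0 < delta ->
  exists L0 : R, forall L, L0 <= L ->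
  exists (I : finType) (M : {set I}) (n : I -> nat) (f : I -> R),
  [/\ injective n /\ (forall q, prime q -> expR L <= q%:R -> forall i, coprime q (n i)),
      forall i, 0 <= f i, 0 < \sum_(i in M) f i ^+ 2, #|M|%:R <= expR L &
      expR ((Num.sqrt 2 - delta) * Num.sqrt (L * ln (ln L) / ln L)) * \sum_(i in M) f i ^+ 2 <=
      \sum_(1 <= a < (Num.truncn (expR L)).+1) invsqrt R a *
        \sum_(i in M) \sum_(j in M | n j == (a * n i)%N) f i * f j].
Proof.
move=> d0; pose k := maxn 4 (Num.truncn (20 / delta)).+1.
have k4 : (4 <= k)%N by rewrite leq_maxl.
have kR4 : 4 <= k%:R :> R by rewrite ler_nat.
have kR0 : 0 < k%:R :> R by exact: lt_le_trans kR4.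
have kd : 10 / k%:R <= delta / 2.
  have h : 20 / delta <= k%:R.
    by apply: le_trans (ltW (truncnS_gt _)) _; rewrite ler_nat leq_maxr.
  rewrite ler_pdivrMr //; rewrite ler_pdivrMr // in h; lra.
pose l0 := Num.max (log_threshold R k) ((2 / delta) ^+ 2).
exists (expR l0) => L LL; pose l := ln L.
have L_gt0 : 0 < L by apply: lt_le_trans LL; apply: expR_gt0.
have LE : L = expR l by rewrite lnK.
have ll : l0 <= l by rewrite -[leLHS]expRK ler_ln ?posrE ?expR_gt0.
have /andP[l1 l2] : (log_threshold R k <= l) && ((2 / delta) ^+ 2 <= l) by rewrite -ge_max.
have [I [M [n [f [h1 h2 h3 h4 h5]]]]] := resonator_of_large_log k4 l1.
rewrite -LE in h1 h4 h5; exists I, M, n, f; split => //; apply: le_trans h5.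
rewrite ler_wpM2r ?(ltW h3) // ler_expR -/l.
set Y := Num.sqrt (L * ln l / l).
have /andP[_ l3] : (expR (2 * k%:R * (128 * k%:R * (k.*2.+1)`!%:R + 6 * k%:R ^+ 2)) <= l) &&
  ((120 * k%:R) ^+ 2 <= l) by rewrite -ge_max.
have l5 : 120 * 120 <= l.
  have := sqr_ge0 (k%:R - 1 : R); move: l3; rewrite !expr2; nra.
have Y2 : 2 / delta <= Y.
  rewrite -[leLHS]ger0_norm; last by rewrite divr_ge0 // ltW.
  by rewrite -sqrtr_sqr ler_wsqrtr //; apply: le_trans l2 _; rewrite LE scale_ge.
have s2 : Num.sqrt 2 <= 2 :> R.
  by rewrite -[leRHS]ger0_norm // -sqrtr_sqr ler_wsqrtr // expr2; lra.
have s0 : 0 <= Num.sqrt 2 :> R by exact: sqrtr_ge0.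
have Y0 : 0 <= Y by exact: sqrtr_ge0.
have dY : 1 <= delta / 2 * Y.
  by move: Y2; rewrite ler_pdivrMr // => h; lra.
have k0 : 0 <= 5 / k%:R :> R by rewrite divr_ge0.
have kd2 : 2 * (5 / k%:R) <= delta / 2 :> R by rewrite mulrA -natrM.
have h1' : Num.sqrt 2 * (5 / k%:R) <= delta / 2 by apply: le_trans kd2; rewrite ler_wpM2r.
have := ler_wpM2r Y0 h1'; move: dY; move: (Num.sqrt 2) (5 / k%:R) => s z; clear; nra.
Qed.

(** * Large values *)

Section LargeValue.
Variable R : realType.

Lemma sum_invsqrt_le n : \sum_(1 <= a < n.+1) invsqrt R a <= 2 * Num.sqrt n%:R.
Proof.
elim: n => [|n IH]; first by rewrite big_geq // sqrtr0 mulr0.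
rewrite big_nat_recr //=; apply: le_trans (lerD IH (lexx _)) _.
have [s0 t0] : 0 <= Num.sqrt n%:R :> R /\ 0 < Num.sqrt n.+1%:R :> R.
  by rewrite sqrtr_ge0 sqrtr_gt0 ltr0n.
have ss : Num.sqrt n%:R ^+ 2 = n%:R :> R by rewrite sqr_sqrtr.
have tt : Num.sqrt n.+1%:R ^+ 2 = n%:R + 1 :> R by rewrite sqr_sqrtr // natr1.
rewrite /invsqrt; move: (Num.sqrt n%:R) (Num.sqrt n.+1%:R) s0 t0 ss tt => s t s0 t0 ss tt.
rewrite -lerBrDl -div1r ler_pdivrMr //.
have : 0 <= (t - s) ^+ 2 by exact: sqr_ge0.
move: ss tt; rewrite !expr2 => ss tt; nra.
Qed.

Lemma ln_div_decreasing (l t : R) : 0 < l -> 1 <= ln l -> l <= t -> ln t / t <= ln l / l.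
Proof.
move=> l0 l1 lt; have t0 : 0 < t by lra.
rewrite ler_pdivrMr // [leRHS](_ : _ = t / l * ln l); last by ring.
have h := ln_div_le l0 t0.
have h1 : 1 <= t / l by rewrite ler_pdivlMr // mul1r.
move: (t / l) h h1 => u h h1; nra.
Qed.

(** The statement has iterated logarithms of [H], the resonator those of
    [L = ln (H / sqrt q) <= ln H]; as [ln t / t] decreases, the latter ratio is
    the larger one. *)
Lemma iterlog_ratio_le (z L : R) : expR (expR (expR 2)) <= L -> L <= ln z ->
  iterlog 3 z / iterlog 2 z <= ln (ln L) / ln L.
Proof.
move=> L3 Lz.
have e x : x <= expR x :> R by have := expR_ge1Dx x; lra.
have L0 : 0 < L by apply: lt_le_trans L3; apply: expR_gt0.
have l3 : expR (expR 2) <= ln L by rewrite -[leLHS]expRK ler_ln ?posrE ?expR_gt0.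
have l0 : 0 < ln L by apply: lt_le_trans l3; apply: expR_gt0.
have ll3 : expR 2 <= ln (ln L) by rewrite -[leLHS]expRK ler_ln ?posrE ?expR_gt0.
have e2 := e 2; have e3 := e (expR 2); have e4 := e (expR (expR 2)).
have lt : ln L <= ln (ln z) by rewrite ler_ln ?posrE // (lt_le_trans L0).
have llt : ln (ln L) <= ln (ln (ln z)) by rewrite ler_ln ?posrE // (lt_le_trans l0).
have -> : iterlog 2 z = ln (ln z).
  rewrite /iterlog /=; have -> : Num.max 2 (ln z) = ln z by apply/max_idPr; lra.
  by apply/max_idPr; lra.
have -> : iterlog 3 z = ln (ln (ln z)).
  rewrite /iterlog /=; have -> : Num.max 2 (ln z) = ln z by apply/max_idPr; lra.
  have -> : Num.max 2 (ln (ln z)) = ln (ln z) by apply/max_idPr; lra.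
  by apply/max_idPr; lra.
apply: ln_div_decreasing => //; lra.
Qed.

(** Suppose that all values at non-principal characters are below [V]. The
    resonator for [L = ln (H / sqrt q)], which is at least [eps * ln q], makes
    the first moment, divided by [|G|], at least half of
    [exp ((sqrt 2 - delta / 2) * Y)] times the energy, while that quotient is
    at most [V + 4] times the energy: 4 is the share of the principal
    character, as [2 sqrt q * exp L = 2 H = 4 |G|]. The remaining [delta / 2]
    in the exponent outweighs these constants. *)
Lemma large_value (eps delta : R) : 0 < eps -> 0 < delta <= 1 ->
  exists q0 : nat, forall (q H : nat) (G : {fset dirichlet_char R q}),
    (q0 <= q)%N -> prime q -> (H %| q.-1)%N -> ~~ odd H ->
    group_closed [in G] -> #|` G| = H./2 ->
    q%:R `^ (2^-1 + eps) <= H%:R :> R ->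
    exists chi : dirichlet_char R q, [/\ chi \in G, chi != 1%g &
      (expR ((Num.sqrt 2 - delta) *
         Num.sqrt (ln (H%:R / Num.sqrt q%:R) * iterlog 3 H%:R / iterlog 2 H%:R)))%:C
      <= `| dirichlet_L 2^-1 chi |].
Proof.
move=> eps0 /andP[d0 d1].
have [L0 resL] := resonator_exists (divr_gt0 d0 (ltr0n _ 2)).
(* The entries serve, in turn, the resonator, the removal of the truncations
   from the iterated logarithms, [scale_ge], and [20 / delta <= Y]. *)
pose L1 := Num.max (Num.max L0 (expR (expR (expR 2))))
  (Num.max (expR (120 * 120)) (expR ((20 / delta) ^+ 2))).
(* [16 <= q] gives [4 * sqrt q <= q], and [L1 / eps <= ln q] gives
   [L1 <= L]. *)
exists (maxn 16 (Num.truncn (expR (L1 / eps))).+1) => q H G.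
rewrite geq_max => /andP[q16 qL] pq Hq evH gG cG Hlarge.
have q0 : 0 < q%:R :> R by rewrite ltr0n prime_gt0.
have H0 : 0 < H%:R :> R by apply: lt_le_trans Hlarge; apply: powR_gt0.
have sq0 : 0 < Num.sqrt q%:R :> R by rewrite sqrtr_gt0.
have sq4 : 4 <= Num.sqrt q%:R :> R.
  have -> : 4 = Num.sqrt (4 ^+ 2) :> R by rewrite sqrtr_sqr ger0_norm.
  by rewrite ler_wsqrtr // -natrX ler_nat.
have ssq : Num.sqrt q%:R * Num.sqrt q%:R = q%:R :> R by rewrite -expr2 sqr_sqrtr // ltW.
pose L : R := ln (H%:R / Num.sqrt q%:R); rewrite -/L.
have LE : expR L = H%:R / Num.sqrt q%:R by rewrite lnK // posrE divr_gt0.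
have lnq : L1 / eps <= ln q%:R.
  rewrite -[leLHS]expRK ler_ln ?posrE ?expR_gt0 //.
  by apply: le_trans (ltW (truncnS_gt _)) _; rewrite ler_nat.
have lnsq : ln (Num.sqrt q%:R) = ln q%:R / 2 :> R.
  by rewrite -powR12_sqrt ?ln_powR ?(ltW q0) // mulrC.
have L_eq : L = ln H%:R - ln q%:R / 2 by rewrite /L ln_div ?posrE // lnsq.
have L1L : L1 <= L.
  have : ln (q%:R `^ (2^-1 + eps)) <= ln H%:R :> R by rewrite ler_ln ?posrE ?powR_gt0.
  rewrite ln_powR L_eq; move: lnq; rewrite ler_pdivrMr //; lra.
have lnq0 : 0 <= ln q%:R :> R by rewrite ln_ge0 // ler1n prime_gt0.
have LH : L <= ln H%:R by rewrite L_eq; lra.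
have [[L0L L3] [L120 Ld]] : (L0 <= L /\ expR (expR (expR 2)) <= L) /\
    (expR (120 * 120) <= L /\ expR ((20 / delta) ^+ 2) <= L).
  by move: L1L; rewrite /L1 !ge_max => /andP[/andP[-> ->] /andP[-> ->]].
have L_gt0 : 0 < L by apply: lt_le_trans L120; apply: expR_gt0.
have [I [M [n [f [[n_inj n_cop] f0 E0 cardM main]]]]] := resL L L0L.
have Hq' : H%:R <= q%:R :> R.
  rewrite ler_nat; apply: leq_trans (leq_pred q); apply: dvdn_leq Hq.
  by have := prime_gt1 pq; case: (q) => [|[]].
have expL : expR L <= Num.sqrt q%:R by rewrite LE ler_pdivrMr // ssq.
pose Y : R := Num.sqrt (L * ln (ln L) / ln L).
pose Y' : R := Num.sqrt (L * iterlog 3 H%:R / iterlog 2 H%:R).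
have YY : Y' <= Y.
  by rewrite ler_wsqrtr // -!mulrA ler_wpM2l ?(ltW L_gt0) // iterlog_ratio_le.
have Yd : 20 / delta <= Y.
  have l1 : (20 / delta) ^+ 2 <= ln L by rewrite -[leLHS]expRK ler_ln ?posrE ?expR_gt0.
  have l2 : 120 * 120 <= ln L by rewrite -[leLHS]expRK ler_ln ?posrE ?expR_gt0.
  rewrite -[leLHS]ger0_norm; last by rewrite divr_ge0 // ltW.
  rewrite -sqrtr_sqr ler_wsqrtr //; apply: le_trans l1 _.
  by have := scale_ge l2; rewrite lnK.
apply: contrapT => none; rewrite -/Y' in none.
pose V : R := expR ((Num.sqrt 2 - delta) * Y').
have bound chi : chi \in G -> chi != 1%g ->
    `|\sum_(1 <= a < q) (kernel R q a)%:C * chi a%:R| <= V%:C.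
  move=> cG' c1; rewrite -dirichlet_L_half //; apply: ltW.
  rewrite real_ltNge ?normr_real //; last by rewrite realE ler0c expR_ge0.
  by apply/negP => VL; apply: none; exists chi.
have aq a : (0 < a < q)%N -> (0 < a <= q)%N by move=> /andP[-> /ltnW ->].
have kernel0 a : (0 < a < q)%N -> 0 <= kernel R q a.
  move=> h; apply: le_trans (kernel_ge R pq (aq _ h)).
  by rewrite subr_ge0; case/andP: h => h1 h2; apply: invsqrt_le => //; apply: ltnW.
have expLq : expR L <= q%:R by apply: le_trans expL _; rewrite -[leRHS]ssq ler_peMr ?(ltW sq0) //; lra.
have := resonance gG M pq n_inj (n_cop q pq expLq) f0 kernel0 (expR_ge0 _) bound.
set A := Num.truncn (expR L) in main.
set pairs := (fun a : nat => \sum_(i in M) \sum_(j in M | n j == (a * n i)%N) f i * f j : R).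
set E := \sum_(i in M) f i ^+ 2 in main E0 *.
rewrite -/(\sum_(1 <= a < q) kernel R q a * pairs a) => moment.
have pairs0 a : 0 <= pairs a by do 2!apply: sumr_ge0 => ? _; rewrite mulr_ge0.
have A_le : A%:R <= Num.sqrt q%:R :> R by apply: le_trans expL; rewrite truncn_le expR_ge0.
have Aq : (A.+1 <= q)%N.
  by rewrite -(ltr_nat R); apply: le_lt_trans A_le _; rewrite -[ltRHS]ssq ltr_pMl //; lra.
have lower : 1 / 2 * (expR ((Num.sqrt 2 - delta / 2) * Y) * E) <=
    \sum_(1 <= a < q) kernel R q a * pairs a.
  apply: le_trans (ler_wpM2l _ main) _ => //.
  rewrite [leRHS](@big_cat_nat _ _ _ A.+1) //= mulr_sumr -[leLHS]addr0; apply: lerD.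
    rewrite !big_nat; apply: ler_sum => a /andP[a0 aA]; rewrite mulrA; apply: (ler_wpM2r (pairs0 a)).
    have aq' : (0 < a <= q)%N by rewrite a0 (leq_trans _ Aq) // ltnW.
    apply: le_trans (kernel_ge R pq aq').
    suff : invsqrt R q <= 1 / 2 * invsqrt R a by lra.
    have sa0 : 0 < Num.sqrt a%:R :> R by rewrite sqrtr_gt0 ltr0n.
    rewrite /invsqrt div1r -invfM lef_pV2 ?posrE ?mulr_gt0 //.
    have -> : 2 = Num.sqrt (2 ^+ 2) :> R by rewrite sqrtr_sqr ger0_norm.
    rewrite -sqrtrM ?sqr_ge0 // ler_wsqrtr //.
    have : a%:R <= Num.sqrt q%:R :> R by apply: le_trans A_le; rewrite ler_nat -ltnS.
    have : 4 * Num.sqrt q%:R <= q%:R :> R by rewrite -[leRHS]ssq ler_pM2r.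
    by rewrite expr2; lra.
  rewrite big_nat; apply: sumr_ge0 => a /andP[aA aq'].
  by rewrite mulr_ge0 ?kernel0 // aq' andbT (leq_trans _ aA).
have kernel_sum : \sum_(1 <= a < q) kernel R q a <= 2 * Num.sqrt q%:R.
  apply: (@le_trans _ _ (\sum_(1 <= a < q) invsqrt R a)).
    rewrite !big_nat; apply: ler_sum => a h; exact: kernel_le (aq _ h).
  have := sum_invsqrt_le q.-1; rewrite prednK ?prime_gt0 // => h; apply: le_trans h _.
  by rewrite ler_wpM2l // ler_wsqrtr // ler_nat leq_pred.
have HG : H%:R = 2 * #|` G|%:R :> R.
  by rewrite cG -natrM mul2n even_halfK.
have G0 : 0 < #|` G|%:R :> R by move: H0; rewrite HG; lra.
have principal : (\sum_(1 <= a < q) kernel R q a) * #|M|%:R <= 4 * #|` G|%:R.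
  apply: (@le_trans _ _ (2 * Num.sqrt q%:R * (H%:R / Num.sqrt q%:R))).
    apply: ler_pM => //; first by rewrite big_nat; apply: sumr_ge0 => a; apply: kernel0.
    by rewrite -LE.
  by rewrite mulrACA divff ?gt_eqF // mulr1 HG; lra.
have {moment principal lower kernel_sum} : 1 / 2 * expR ((Num.sqrt 2 - delta / 2) * Y) <= V + 4.
  have h1 := ler_wpM2l (ltW G0) lower.
  have h2 := ler_wpM2r (ltW E0) principal.
  rewrite -(ler_pM2l G0) -(ler_pM2r E0).
  move: h1 moment h2; rewrite -/V; lra.
have dsqrt : delta <= Num.sqrt 2 :> R.
  by apply: (le_trans d1); rewrite -[leLHS]sqrtr1 ler_wsqrtr // ler1n.
have Y0 : 0 <= Y by exact: sqrtr_ge0.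
have VW : V <= expR ((Num.sqrt 2 - delta) * Y).
  by rewrite ler_expR ler_wpM2l // subr_ge0.
have W1 : 1 <= expR ((Num.sqrt 2 - delta) * Y).
  by rewrite -[leLHS]expR0 ler_expR mulr_ge0 // subr_ge0.
have big : 11 <= expR (delta / 2 * Y).
  apply: le_trans (expR_ge1Dx _).
  have : 20 <= delta * Y by rewrite mulrC -ler_pdivrMr.
  lra.
have -> : (Num.sqrt 2 - delta / 2) * Y = (Num.sqrt 2 - delta) * Y + delta / 2 * Y by field.
rewrite expRD => total.
have : 11 * expR ((Num.sqrt 2 - delta) * Y) <=
    expR ((Num.sqrt 2 - delta) * Y) * expR (delta / 2 * Y).
  by rewrite mulrC ler_wpM2l ?expR_ge0.
have := W1; have := VW; have := total; lra.
Qed.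

End LargeValue.


(** [large_value] gives every fixed slack [delta] from some [q] on. The
    function [o] is obtained by taking, for each [q], nearly the infimum of the
    slacks that are admissible for all [H] and all groups. The factor
    [(H / q) ^ (1 / 2)] is at most 1. *)
Theorem theorem2p4 (R : realType) (eps : R) (heps : 0 < eps) :
  exists (c : R) (o : nat -> R) (q0 : nat),
  [/\ 0 < c, o n @[n --> \oo] --> (0 : R) &
    forall (q H : nat) (calH calHplus : {fset dirichlet_char R q}),
      (q0 <= q)%N -> prime q ->
      (H %| q.-1)%N -> ~~ odd H ->
      group_closed [in calH] -> #|` calH| = H ->
      group_closed [in calHplus] -> #|` calHplus| = H./2 ->
      q%:R `^ (2^-1 + eps) <= H%:R :> R ->
      {in calHplus, forall psi, even_dchar psi} /\
      exists chi : dirichlet_char R q,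
        [/\ chi \in calHplus, chi != 1%g &
          (c * (H%:R / q%:R) `^ 2^-1 *
           expR ((Num.sqrt 2 + o q) *
                 Num.sqrt (ln (H%:R / Num.sqrt q%:R) * iterlog 3 H%:R
                           / iterlog 2 H%:R)))%:C
          <= `| dirichlet_L 2^-1 chi |]].
Proof.
pose scale (q H : nat) : R :=
  Num.sqrt (ln (H%:R / Num.sqrt q%:R) * iterlog 3 H%:R / iterlog 2 H%:R).
pose admissible (q : nat) : set R := [set delta | 0 < delta /\
  forall (H : nat) (G : {fset dirichlet_char R q}),
    prime q -> (H %| q.-1)%N -> ~~ odd H ->
    group_closed [in G] -> #|` G| = H./2 -> q%:R `^ (2^-1 + eps) <= H%:R :> R ->
    exists chi : dirichlet_char R q, [/\ chi \in G, chi != 1%g &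
      (expR ((Num.sqrt 2 - delta) * scale q H))%:C <= `| dirichlet_L 2^-1 chi |]].
have eventually delta : 0 < delta <= 1 ->
    exists q0, forall q, (q0 <= q)%N -> admissible q delta.
  move=> hd; have [q0 hq0] := large_value heps hd; exists q0 => q hq; split.
    by case/andP: hd.
  by move=> H G *; apply: hq0.
have adm_ge0 q : lbound (admissible q) 0 by move=> delta [/ltW].
pose slack (n : nat) : R := inf (admissible n) + n.+1%:R^-1.
have [q1 hq1] := eventually 1 ltac:(by rewrite ltr01 lexx).
have has_inf_adm q : (q1 <= q)%N -> has_inf (admissible q).
  by move=> hq; split; [exists 1; apply: hq1 | exists 0; apply: adm_ge0].
exists 1, (fun n => - slack n), q1; split => //.
- rewrite -oppr0; apply: cvgN; apply/cvgrPdist_le => e e0.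
  have e2 : 0 < Num.min 1 (e / 2) <= 1.
    by rewrite ge_min lexx lt_min ltr01 divr_gt0.
  have [q2 hq2] := eventually _ e2.
  exists (maxn (maxn q1 q2) (Num.truncn (2 / e))) => // n /=.
  rewrite !geq_max => /andP[/andP[hn1 hn2] hn3].
  have inf0 : 0 <= inf (admissible n).
    by apply: lb_le_inf => //; case: (has_inf_adm n hn1).
  have inf1 : inf (admissible n) <= e / 2.
    apply: (@le_trans _ _ (Num.min 1 (e / 2))); last by rewrite ge_min lexx orbT.
    by apply: ge_inf; [case: (has_inf_adm n hn1) | apply: hq2].
  have n1 : n.+1%:R^-1 <= e / 2.
    rewrite -[leRHS]invrK lef_pV2 ?posrE ?invr_gt0 ?divr_gt0 // invf_div.
    by apply: le_trans (ltW (truncnS_gt _)) _; rewrite ler_nat ltnS.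
  rewrite sub0r normrN ger0_norm /slack; last by rewrite addr_ge0.
  by rewrite [leRHS]splitr lerD.
move=> q H calH G hq pq Hq evH _ _ gG cG Hlarge; split; first exact: subgroup_even cG.
have [delta [d0 adm] dlt] : exists2 delta, admissible q delta & delta < slack q.
  by apply: inf_adherent; [rewrite invr_gt0 | apply: has_inf_adm].
have [chi [chiG chi1 bound]] := adm H G pq Hq evH gG cG Hlarge.
exists chi; split => //; apply: le_trans bound; rewrite lecR mul1r -/(scale q H).
have q0 : 0 < q%:R :> R by rewrite ltr0n prime_gt0.
have Hq1 : (H%:R / q%:R) `^ 2^-1 <= 1 :> R.
  rewrite powR12_sqrt ?divr_ge0 // -[leRHS]sqrtr1 ler_wsqrtr // ler_pdivrMr // mul1r ler_nat.
  by apply: leq_trans (leq_pred q); apply: dvdn_leq Hq; have := prime_gt1 pq; case: (q) => [|[]].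
rewrite -[leRHS]mul1r; apply: ler_pM; rewrite ?powR_ge0 ?expR_ge0 // ler_expR.
by rewrite ler_wpM2r ?sqrtr_ge0 // lerD2l lerN2 ltW.
Qed.
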